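(* Let $\dot A$ be a symmetric densely defined closed operator with deficiency indices $(1,1)$ in a Hilbert space $\mathcal H$ and let $g_\pm\in\operatorname{Ker}(\dot A^*\mp iI)$ be $(+)$-normalized deficiency vectors, $\|g_\pm\|_+=1$. Assume that $A$ is a self-adjoint extension of $\dot A$ such that $g_+-g_-\in\mathrm{Dom}(A)$, and let $M_{(\dot A,A)}(z)$ denote the Weyl-Titchmarsh function of the pair $(\dot A,A)$. Then $M_{(\dot A,A)}(z)$ can be represented as the impedance function of an L-system of the form $$\Theta_{10}=\begin{pmatrix}\mathbb A_{10}&K_{10}&1\\ \mathcal H_+\subset\mathcal H\subset\mathcal H_-&&\mathbb C\end{pmatrix},\qquad \mathbb A_{10}=\dot A^*-i(\cdot,\psi)(\varphi-\psi),\quad K_{10}c=c\cdot\tfrac1{\sqrt2}(\varphi-\psi)\ (c\in\mathbb C),$$ where $\varphi=\mathcal R^{-1}g_+$, $\psi=\mathcal R^{-1}g_-$, with c-entropy $\mathcal S$ and coefficient of dissipation $\mathcal D$ of the main operator of $\Theta_{10}$ given by $$\mathcal S=\infty\quad\text{and}\quad\mathcal D=1.$$ Moreover, if $\Theta$ is an L-system with state-space operator $\mathbb A$ and symmetric operator $\dot A$ such that $V_\Theta(z)=M_{(\dot A,A)}(z)$ for $z\in\mathbb C_+$, where $A=\hat A$ is the quasi-kernel of $\mathrm{Re}\,\mathbb A$, then $\Theta$ has infinite c-entropy and the coefficient of dissipation of its main operator is $1$.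
   Context: Inner products are linear in the first argument. $\mathbb C_\pm$ are the open upper and lower half-planes. Rigged space. For a closed densely defined symmetric $\dot A$ in $\mathcal H$, $\mathcal H_+=\mathrm{Dom}(\dot A^* )$ with $(f,g)_+=(f,g)+(\dot A^*f,\dot A^*g)$, and $\mathcal H_-$ is the corresponding negative space (dual of $\mathcal H_+$ with respect to the pairing extending the inner product of $\mathcal H$, also written $(\cdot,\cdot)$), so $\mathcal H_+\subset\mathcal H\subset\mathcal H_-$. The Riesz-Berezansky operator $\mathcal R$ is the isometric (linear) map of $\mathcal H_-$ onto $\mathcal H_+$ with $(f,g)=(f,\mathcal Rg)_+$ for $f\in\mathcal H_+$, $g\in\mathcal H_-$. $[\mathcal H_1,\mathcal H_2]$ denotes bounded linear operators. For $\mathbb A\in[\mathcal H_+,\mathcal H_-]$ the adjoint $\mathbb A^*\in[\mathcal H_+,\mathcal H_-]$ is taken with respect to the pairing; $\mathrm{Re}\,\mathbb A=\frac12(\mathbb A+\mathbb A^* )$, $\mathrm{Im}\,\mathbb A=\frac1{2i}(\mathbb A-\mathbb A^* )$. For $u,v\in\mathcal H_-$, $(\cdot,u)v$ denotes the operator $f\mapsto(f,u)v$ from $\mathcal H_+$ to $\mathcal H_-$. Extensions. A quasi-self-adjoint extension of $\dot A$ is a non-symmetric operator $T$ in $\mathcal H$ with $\dot A\subset T\subset\dot A^*$. A self-adjoint bi-extension of $\dot A$ is $\mathbb B\in[\mathcal H_+,\mathcal H_-]$ with $\dot A\subset\mathbb B=\mathbb B^*$; its quasi-kernel is the restriction of $\mathbb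 B$ to $\{f\in\mathcal H_+:\mathbb Bf\in\mathcal H\}$; it is t-self-adjoint if its quasi-kernel is self-adjoint in $\mathcal H$. If $T$ is a quasi-self-adjoint extension of $\dot A$ with $\rho(T)\neq\emptyset$, a $( * )$-extension of $T$ is $\mathbb A\in[\mathcal H_+,\mathcal H_-]$ with $\mathbb A\supset T\supset\dot A$, $\mathbb A^*\supset T^*\supset\dot A$ and $\mathrm{Re}\,\mathbb A$ a t-self-adjoint bi-extension of $\dot A$. L-system. An array $\Theta=\begin{pmatrix}\mathbb A&K&1\\ \mathcal H_+\subset\mathcal H\subset\mathcal H_-&&\mathbb C\end{pmatrix}$ is an L-system if (1) $T$ is a dissipative ($\mathrm{Im}(Tf,f)\ge0$, $f\in\mathrm{Dom}(T)$) quasi-self-adjoint extension, with $\rho(T)\ne\emptyset$, of a symmetric operator $\dot A$ with deficiency indices $(1,1)$; (2) $\mathbb A$ is a $( * )$-extension of $T$; (3) $\mathrm{Im}\,\mathbb A=KK^*$ with $K\in[\mathbb C,\mathcal H_-]$, $K^*\in[\mathcal H_+,\mathbb C]$. Here $\dot A$, $T$, $\mathbb A$, $K$ are the symmetric, main, state-space and channel operators. The transfer function is $W_\Theta(z)=I-2iK^*(\mathbb A-zI)^{-1}K$, $z\in\rho(T)$, and the impedance function is $V_\Theta(z)=K^*(\mathrm{Re}\,\mathbb A-zI)^{-1}K$ for nonreal $z\in\rho(T)$, extended analytically to all of $\mathbb C_\pm$. Weyl-Titchmarsh function: for a self-adjoint extension $A$ of $\dot A$, $M_{(\dot A,A)}(z)=((Az+I)(A-zI)^{-1}g,g)$,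 $z\in\mathbb C_+$, where $g\in\operatorname{Ker}(\dot A^*-iI)$ has $\|g\|=1$ in the norm of $\mathcal H$ (e.g. $g=\sqrt2\,g_+$ for $(+)$-normalized $g_+$). c-entropy: $\mathcal S=-\ln(|W_\Theta(-i)|)$, with $\mathcal S=\infty$ if $W_\Theta(-i)=0$. Coefficient of dissipation: let $g'_\pm=\sqrt2\,g_\pm$, so $\|g'_\pm\|=1$ in $\mathcal H$, and let $\kappa$ be the von Neumann parameter of $T$, i.e. the number $|\kappa|<1$ with $g'_+-\kappa g'_-\in\mathrm{Dom}(T)$ (in the definition it is required that the basis is such that $0\le\kappa\le1$). With $\tilde y=g'_+-\kappa g'_-$, $\mathcal D=\mathrm{Im}(T\tilde y,\tilde y)$. *)

(* Defs.v *)
From HB Require Import structures.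
From mathcomp Require Import all_boot all_order all_algebra.
From mathcomp Require Import sesquilinear complex.
From mathcomp Require Import ring.
From mathcomp Require Import all_classical all_reals all_analysis.

Set Implicit Arguments.
Unset Strict Implicit.
Unset Printing Implicit Defensive.
Import Order.TTheory GRing.Theory Num.Theory.
Import numFieldNormedType.Exports.
Local Open Scope classical_set_scope.
Local Open Scope ring_scope.

HB.mixin Record CompleteNormedModule_isHilbert (R : realType) (H : Type)
    of CompleteNormedModule R[i] H := {
  inner : {dot H for (@Num.conj R[i])};
  sqr_normE : forall x : H, `|x| ^+ 2 = inner x x }.

#[short(type="hilbertType")]
HB.structure Definition Hilbert (R : realType) :=
  {H of CompleteNormedModule R[i] H & CompleteNormedModule_isHilbert R H}.

Notation "''[' x , y ]" := (inner x y) : ring_scope.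

Lemma dot_conj (C : numClosedFieldType) (U : lmodType C)
    (d : {dot U for (@Num.conj C)}) (u v : U) : d u v = (d v u)^*.
Proof. by rewrite hermC/= expr0 mul1r. Qed.

Lemma dot_ge0 (C : numClosedFieldType) (U : lmodType C)
    (d : {dot U for (@Num.conj C)}) (u : U) : 0 <= d u u.
Proof.
have [->|u0] := eqVneq u 0; first by rewrite linear0r.
exact/ltW/neq0_dnorm_gt0.
Qed.

Lemma dot_CauchySchwarz (C : numClosedFieldType) (U : lmodType C)
    (d : {dot U for (@Num.conj C)}) (u v : U) :
  `|d u v| <= sqrtC (d u u) * sqrtC (d v v).
Proof.
have [->|v0] := eqVneq v 0; first by rewrite !linear0r sqrtC0 normr0 mulr0.
have dv : 0 < d v v by exact: neq0_dnorm_gt0.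
rewrite -(sqrCK (normr_ge0 _)) -sqrtCM ?nnegrE ?dot_ge0//.
rewrite ler_sqrtC ?nnegrE ?exprn_ge0 ?mulr_ge0 ?dot_ge0//.
pose a := d u v / d v v.
have := dot_ge0 d (u - a *: v).
rewrite linearBl /= linearZl_LR /= !linearBr /= !linearZr_LR /=.
rewrite (dot_conj d v u) rmorphM fmorphV /= -(dot_conj d v v) /a.
rewrite /GRing.scale /=.
rewrite (_ : _ - _ - _ = d u u - `|d u v| ^+ 2 / d v v); last first.
  by rewrite normCK; field; rewrite gt_eqF.
by rewrite subr_ge0 ler_pdivrMr.
Qed.


Section Operators.
Variables (R : realType) (H : hilbertType R).
Local Notation C := R[i].

(* Unbounded operators in H are represented by their graphs, so that inclusion
   of operators is inclusion of sets. *)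
Definition dom (G : set (H * H)) : set H := [set f | exists h, G (f, h)].

(* The value of the operator G at f (and 0 if f is not in the domain). *)
Definition app (G : set (H * H)) (f : H) : H := xget 0 [set h | G (f, h)].

Record operator := Operator {
  graph :> set (H * H);
  graph0 : graph 0;
  graph_linear : forall (a : C) p q, graph p -> graph q -> graph (a *: p + q);
  graph_functional : forall f h k, graph (f, h) -> graph (f, k) -> h = k }.

Definition adjoint (G : set (H * H)) : set (H * H) :=
  [set p | forall q, G q -> '[q.2, p.1] = '[q.1, p.2]].

Definition symmetric_graph (G : set (H * H)) : Prop := G `<=` adjoint G.

Definition self_adjoint (G : set (H * H)) : Prop := adjoint G = G.

Definition dissipative (G : set (H * H)) : Prop :=
  forall p, G p -> 0 <= complex.Im '[p.2, p.1].

Definition resolvent_set (G : set (H * H)) : set C :=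
  [set z | (forall h, exists2 p, G p & p.2 - z *: p.1 = h) /\
           exists M : C, forall p, G p -> `|p.1| <= M * `|p.2 - z *: p.1|].

Definition resolvent (G : set (H * H)) (z : C) (h : H) : H :=
  xget 0 [set f | exists2 k, G (f, k) & k - z *: f = h].

Record symmetric_operator := SymmetricOperator {
  sym_op :> operator;
  sym_dense : dense (dom sym_op);
  sym_closed : closed (sym_op : set (H * H));
  sym_symmetric : symmetric_graph sym_op }.

Lemma normE (x : H) : `|x| = sqrtC '[x, x].
Proof. by rewrite -sqr_normE sqrCK. Qed.

Lemma dense_orthogonal (D : set H) (w : H) :
  dense D -> (forall x, D x -> '[x, w] = 0) -> w = 0.
Proof.
move=> dD Dw; apply/eqP/negPn/negP => w0.
have nw : 0 < `|w| by rewrite normr_gt0.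
have [|//=|x [xw Dx]] := dD (ball w `|w|).
  by exists w; exact: ballxx.
  exact: ball_open.
move: xw; rewrite -ball_normE /= => xw.
have : `|w| ^+ 2 <= `|w - x| * `|w|.
  rewrite -[leLHS]ger0_norm ?exprn_ge0// sqr_normE.
  rewrite -[in leLHS](subrK x w) linearDl /= [X in _ + X](_ : _ = 0); last first.
    by rewrite subrK Dw.
  by rewrite addr0 subrK [leRHS](_ : _ = sqrtC '[w - x, w - x] * sqrtC '[w, w])
     ?dot_CauchySchwarz// !normE.
by rewrite expr2 ler_pM2r// (lt_geF xw).
Qed.

Lemma adjoint_linear (G : set (H * H)) (a : C) p q :
  adjoint G p -> adjoint G q -> adjoint G (a *: p + q).
Proof.
move=> Gp Gq r Gr /=.
by rewrite !linearD /= !linearZ /= Gp// Gq.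
Qed.

Lemma adjoint_functional (G : set (H * H)) f h k : dense (dom G) ->
  adjoint G (f, h) -> adjoint G (f, k) -> h = k.
Proof.
move=> dG Gh Gk; apply/eqP; rewrite -subr_eq0; apply/eqP.
apply: (dense_orthogonal dG) => x [y Gxy].
by rewrite linearB /= -(Gh _ Gxy) -(Gk _ Gxy) subrr.
Qed.

End Operators.

Arguments operator {R} H.
Arguments symmetric_operator {R} H.

Section RiggedSpace.
Variables (R : realType) (H : hilbertType R) (Adot : symmetric_operator H).
Local Notation C := R[i].

Definition dom_adjoint : {pred H} := fun f => `[< dom (adjoint Adot) f >].

Lemma dom_adjoint_submod : GRing.subsemimod_closed dom_adjoint.
Proof.
have lin a f g : f \in dom_adjoint -> g \in dom_adjoint ->
    a *: f + g \in dom_adjoint.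
  move=> /asboolP[h Sh] /asboolP[k Sk]; apply/asboolP; exists (a *: h + k).
  exact: (adjoint_linear a Sh Sk).
have z : 0 \in dom_adjoint.
  by apply/asboolP; exists 0 => p _ /=; rewrite !linear0r.
split; first split=> //.
  by move=> f g df dg; rewrite -[f]scale1r; exact: lin.
by move=> a f df; rewrite -[a *: f]addr0; exact: lin.
Qed.

HB.instance Definition _ :=
  GRing.isSubmodClosed.Build C H dom_adjoint dom_adjoint_submod.

(* The positive space H_+, the domain of the adjoint of Adot. *)
Record hplus := Hplus { hval :> H ; hvalP : hval \in dom_adjoint }.

HB.instance Definition _ := [isSub for hval].
HB.instance Definition _ := [Choice of hplus by <:].
HB.instance Definition _ := [SubChoice_isSubLmodule of hplus by <:].

Definition Astar (f : hplus) : H := app (adjoint Adot) f.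

Lemma AstarP (f : hplus) : adjoint Adot (hval f, Astar f).
Proof. by have /asboolP := hvalP f; exact: xgetPex. Qed.

Lemma AstarE (f : hplus) (h : H) : adjoint Adot (hval f, h) -> Astar f = h.
Proof. exact: adjoint_functional (sym_dense Adot) (AstarP f). Qed.

Lemma Astar_is_linear : linear Astar.
Proof.
by move=> a f g; apply: AstarE; exact: adjoint_linear (AstarP f) (AstarP g).
Qed.

HB.instance Definition _ :=
  GRing.isLinear.Build C hplus H _ Astar Astar_is_linear.

Definition inner_plus (f g : hplus) : C :=
  '[hval f, hval g] + '[Astar f, Astar g].

Lemma inner_plus_bilinear : bilinear_for *%R (Num.conj \; *%R) inner_plus.
Proof.
split=> [g|g] a f h; rewrite /inner_plus !linearP /=.
  by rewrite !linearDl !linearZl_LR /= mulrDr addrACA.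
by rewrite mulrDr addrACA.
Qed.

HB.instance Definition _ := bilinear_isBilinear.Build C hplus hplus C
  *%R (Num.conj \; *%R) inner_plus inner_plus_bilinear.

Lemma inner_plus_hermitian (f g : hplus) :
  inner_plus f g = (-1) ^+ false * (inner_plus g f)^*.
Proof.
by rewrite mul1r /inner_plus rmorphD /= -!dot_conj.
Qed.

HB.instance Definition _ := isHermitianSesquilinear.Build C hplus false
  Num.conj inner_plus inner_plus_hermitian.

Lemma inner_plus_gt0 (f : hplus) : f != 0 -> 0 < inner_plus f f.
Proof.
move=> f0; rewrite ltr_pwDl ?dot_ge0// neq0_dnorm_gt0//.
Qed.

HB.instance Definition _ := isDotProduct.Build C hplus inner_plus inner_plus_gt0.

Definition norm_plus (f : hplus) : C := sqrtC (inner_plus f f).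

Lemma norm_plus_ge0 f : 0 <= norm_plus f.
Proof. by rewrite sqrtC_ge0 dot_ge0. Qed.

Lemma norm_le_plus f : `|hval f| <= norm_plus f.
Proof.
rewrite normE ler_sqrtC ?nnegrE ?dot_ge0//.
by rewrite lerDl dot_ge0.
Qed.

(* The negative space H_-: an element u is represented by the bounded
   antilinear functional f |-> (u, f) on H_+, so that the vector space
   structure is the pointwise one. *)
Definition hminus_pred : {pred (hplus -> C^o)} := fun u =>
  `[< (forall a f g, u (a *: f + g) = a^* * u f + u g) /\
      exists M : C, forall f, `|u f| <= M * norm_plus f >].

Lemma hminus_submod : GRing.subsemimod_closed hminus_pred.
Proof.
split; first split.
- apply/asboolP; split=> [a f g|]; first by rewrite mulr0 addr0.
  by exists 0 => f; rewrite mul0r normr0.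
- move=> u v /asboolP[ul [M uM]] /asboolP[vl [N vN]]; apply/asboolP; split.
    by move=> a f g; rewrite /= !fctE ul vl mulrDr addrACA.
  exists (M + N) => f; rewrite mulrDl; apply: le_trans (ler_normD _ _) _.
  exact: lerD.
- move=> c u /asboolP[ul [M uM]]; apply/asboolP; split.
    move=> a f g; rewrite !fctE ul scalerDr; congr (_ + _).
    by rewrite /GRing.scale /= mulrCA.
  exists (`|c| * M) => f; rewrite normrM -mulrA.
  exact: ler_wpM2l.
Qed.

HB.instance Definition _ :=
  GRing.isSubmodClosed.Build C (hplus -> C^o) hminus_pred hminus_submod.

Record hminus := Hminus {
  hminus_fun :> hplus -> C^o ; hminusP : hminus_fun \in hminus_pred }.

HB.instance Definition _ := [isSub for hminus_fun].
HB.instance Definition _ := [Choice of hminus by <:].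
HB.instance Definition _ := [SubChoice_isSubLmodule of hminus by <:].

Lemma hminus_antilinear (u : hminus) a f g : u (a *: f + g) = a^* * u f + u g.
Proof. by have /asboolP[ul _] := hminusP u; exact: ul. Qed.

Lemma hminus_bounded (u : hminus) : exists M : C, forall f, `|u f| <= M * norm_plus f.
Proof. by have /asboolP[_] := hminusP u. Qed.

(* The pairing (f, u), linear in f and antilinear in u. *)
Definition pairing (f : hplus) (u : hminus) : C := (u f)^*.

Lemma embed_subproof (h : H) : (fun f : hplus => '[h, hval f]) \in hminus_pred.
Proof.
apply/asboolP; split=> [a f g|]; first by rewrite !linearP.
exists `|h| => f; apply: le_trans (dot_CauchySchwarz inner h (hval f)) _.
by rewrite -!normE ler_wpM2l// norm_le_plus.
Qed.

Definition embed (h : H) : hminus := Hminus (embed_subproof h).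

Lemma riesz_inv_subproof (g : hplus) : inner_plus g \in hminus_pred.
Proof.
apply/asboolP; split=> [a f h|]; first exact: inner_plus_bilinear.2.
exists (norm_plus g) => f; exact: (dot_CauchySchwarz inner_plus).
Qed.

(* The inverse of the Riesz-Berezansky operator: (f, R^-1 g) = (f, g)_+. *)
Definition riesz_inv (g : hplus) : hminus := Hminus (riesz_inv_subproof g).

Lemma riesz_invE (f g : hplus) : pairing f (riesz_inv g) = inner_plus f g.
Proof. by rewrite /pairing /= -(dot_conj inner_plus). Qed.

(* The bounded operators [H_+, H_-]; the second condition says that the norm of
   B f in the dual H_- of H_+ is at most M times the norm of f in H_+. *)
Definition bop_pred : {pred (hplus -> hminus)} := fun B =>
  `[< (forall a f g, B (a *: f + g) = a *: B f + B g) /\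
      exists M : C, forall f g, `|B f g| <= M * norm_plus f * norm_plus g >].

Lemma bop_submod : GRing.subsemimod_closed bop_pred.
Proof.
split; first split.
- apply/asboolP; split=> [a f g|]; first by rewrite scaler0 addr0.
  by exists 0 => f g; rewrite !mul0r normr0.
- move=> A B /asboolP[Al [M AM]] /asboolP[Bl [N BN]]; apply/asboolP; split.
    by move=> a f g; rewrite !fctE Al Bl scalerDr addrACA.
  exists (M + N) => f g; rewrite /= !mulrDl; apply: le_trans (ler_normD _ _) _.
  exact: lerD.
- move=> c A /asboolP[Al [M AM]]; apply/asboolP; split.
    by move=> a f g; rewrite !fctE Al scalerDr !scalerA [a * c]mulrC.
  exists (`|c| * M) => f g; rewrite normrM -!mulrA ler_wpM2l// mulrA.
  exact: AM.
Qed.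

HB.instance Definition _ :=
  GRing.isSubmodClosed.Build C (hplus -> hminus) bop_pred bop_submod.

Record bop := Bop { bop_fun :> hplus -> hminus ; bopP : bop_fun \in bop_pred }.

HB.instance Definition _ := [isSub for bop_fun].
HB.instance Definition _ := [Choice of bop by <:].
HB.instance Definition _ := [SubChoice_isSubLmodule of bop by <:].

Lemma bop_adj_fun_subproof (A : bop) (f : hplus) :
  (fun g : hplus => pairing f (A g)) \in hminus_pred.
Proof.
have /asboolP[Al [M AM]] := bopP A; apply/asboolP; split.
  by move=> a g h; rewrite /pairing Al /= !fctE rmorphD rmorphM.
by exists (M * norm_plus f) => g; rewrite norm_conjC mulrAC.
Qed.

Definition bop_adj_fun (A : bop) (f : hplus) : hminus :=
  Hminus (bop_adj_fun_subproof A f).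

Lemma bop_adj_subproof (A : bop) : bop_adj_fun A \in bop_pred.
Proof.
have /asboolP[Al [M AM]] := bopP A; apply/asboolP; split.
  move=> a f g; apply/val_inj/funext => h /=.
  by rewrite /pairing /= hminus_antilinear rmorphD rmorphM /= conjCK.
by exists M => f g; rewrite /= norm_conjC mulrAC.
Qed.

(* The adjoint with respect to the pairing: (A^* f, g) = (f, A g). *)
Definition bop_adj (A : bop) : bop := Bop (bop_adj_subproof A).

Definition bop_re (A : bop) : bop := 2^-1 *: (A + bop_adj A).
Definition bop_im (A : bop) : bop := (2 * 'i)^-1 *: (A - bop_adj A).

(* [extends B T] states that T is contained in B, for a restriction T of the
   adjoint of Adot. *)
Definition extends (B : bop) (T : set (H * H)) : Prop :=
  forall (f : hplus) (h : H), T (hval f, h) -> B f = embed h.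

Definition quasi_kernel (B : bop) : set (H * H) :=
  [set p | exists2 f : hplus, hval f = p.1 & B f = embed p.2].

Definition bi_resolvent (B : bop) (z : C) (u : hminus) : hplus :=
  xget 0 [set f | B f - z *: embed f = u].

Definition quasi_self_adjoint_extension (T : set (H * H)) : Prop :=
  [/\ ~ symmetric_graph T, Adot `<=` T & T `<=` adjoint Adot].

Definition self_adjoint_bi_extension (B : bop) : Prop :=
  extends B Adot /\ bop_adj B = B.

Definition t_self_adjoint_bi_extension (B : bop) : Prop :=
  self_adjoint_bi_extension B /\ self_adjoint (quasi_kernel B).

Definition star_extension (T : set (H * H)) (A : bop) : Prop :=
  [/\ extends A T /\ Adot `<=` T,
      extends (bop_adj A) (adjoint T) /\ Adot `<=` adjoint T &
      t_self_adjoint_bi_extension (bop_re A)].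

(* Ker(Adot^* - z I) *)
Definition deficiency_space (z : C) : set H :=
  [set f | adjoint Adot (f, z *: f)].

Definition dimension_one (E : set H) : Prop :=
  exists2 e, e != 0 & E = [set c *: e | c in [set: C]].

Definition deficiency_indices_1_1 : Prop :=
  dimension_one (deficiency_space 'i) /\ dimension_one (deficiency_space (- 'i)).

(* The adjoint of K : C -> H_- is characterized by (K c, f) = c * (K^* f)^*. *)
Definition channel_adj (K : {linear C^o -> hminus}) (f : hplus) : C :=
  pairing f (K 1).

(* The input-output space is the one-dimensional space C, so every linear K is
   bounded. *)
Record l_system := LSystem {
  main_operator : operator H;
  state_operator : bop;
  channel : {linear C^o -> hminus};
  l_system_deficiency : deficiency_indices_1_1;
  l_system_quasi_self_adjoint : quasi_self_adjoint_extension main_operator;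
  l_system_dissipative : dissipative main_operator;
  l_system_regular : resolvent_set main_operator !=set0;
  l_system_star : star_extension main_operator state_operator;
  l_system_im : forall f,
    bop_im state_operator f = channel (channel_adj channel f) }.

Definition transfer (Theta : l_system) (z : C) : C :=
  let K := channel Theta in
  1 - 2 * 'i * channel_adj K (bi_resolvent (state_operator Theta) z (K 1)).

(* V is the impedance function of Theta on the nonreal points. The last
   condition fixes how V is extended to a half-plane that does not meet the
   resolvent set of the main operator, where analyticity alone says nothing. *)
Definition impedance (Theta : l_system) (V : C -> C) : Prop :=
  let K := channel Theta in
  [/\ forall z : C, complex.Im z != 0 -> derivable (V : C^o -> C^o) z 1,
      forall z : C, complex.Im z != 0 -> resolvent_set (main_operator Theta) z ->
        V z = channel_adj K
                (bi_resolvent (bop_re (state_operator Theta)) z (K 1)) &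
      forall z : C, complex.Im z != 0 -> V z^* = (V z)^*].

Definition c_entropy (Theta : l_system) : \bar R :=
  let w := transfer Theta (- 'i) in
  if w == 0 then +oo%E else (- ln (complex.Re `|w|))%:E.

(* d is the coefficient of dissipation of T with respect to the unit vectors
   gp and gm of Ker(Adot^* - i I) and Ker(Adot^* + i I). *)
Definition dissipation_coefficient (T : set (H * H)) (gp gm : H) (d : R) : Prop :=
  exists kappa : C, exists w : H,
    [/\ 0 <= kappa < 1, T (gp - kappa *: gm, w) &
        d = complex.Im '[w, gp - kappa *: gm]].

End RiggedSpace.

(* ((A z + I) (A - z I)^-1 g, g) *)
Definition weyl_titchmarsh (R : realType) (H : hilbertType R)
    (A : set (H * H)) (g : H) (z : R[i]) : R[i] :=
  let f := resolvent A z g in '[z *: app A f + f, g].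

(* Main.v *)
Require Import Defs.
From HB Require Import structures.
From mathcomp Require Import all_boot all_order all_algebra.
From mathcomp Require Import sesquilinear complex.
From mathcomp Require Import ring lra.
From mathcomp Require Import all_classical all_reals all_analysis.

Set Implicit Arguments.
Unset Strict Implicit.
Unset Printing Implicit Defensive.
Import Order.TTheory GRing.Theory Num.Theory.
Import numFieldNormedType.Exports.
Local Open Scope classical_set_scope.
Local Open Scope ring_scope.

(** Let [a f = (f, g_+)_+] and [b f = (f, g_-)_+] be the coordinates of [f] in
    von Neumann's decomposition
    [Dom S = Dom Adot + span g_+ + span g_-] for the adjoint [S] of [Adot], which
    follows from the projection theorem applied to the closed range of
    [Adot + i]. They give the boundary form
    [(S f, h) - (f, S h) = i (a f conj (a h) - b f conj (b h))].

    Existence: the boundary form shows that the restriction of [S] to [b = 0] is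
    the main operator of [Theta_10], that its adjoint is the restriction to
    [a = 0], and that the quasi-kernel of the real part is the restriction to
    [a + b = 0], which is [A]. The impedance function at [z] is
    [i (a f - b f) / (a f + b f)] for any nonzero [f] in [Ker (S - z)], and the
    choice [f = g + (z - i) (A - z)^-1 g] turns it into [M z]. The solution of
    [(A_10 + i) f = K 1] is [(i / sqrt 2) g_-], whence [W (- i) = 0].

    Converse, for a state-space operator [B + i C] with real part [B] and
    imaginary part [C]: [V i = M i = i], so [V (- i) = - i] by symmetry. If [F]
    solves [(B + i) F = K 1], then [F / 2] solves [(B + i C + i) f = K 1], so that
    [W (- i) = 0]. Moreover [(B - i C) F = - i F] and [F] is a multiple of [g_-],
    hence [b = 0] on [Dom T]; as [T] is not symmetric, [g_+] lies in [Dom T],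
    that is, the von Neumann parameter is [0]. *)

(** * Projection onto closed subspaces *)

Lemma gt0_complexP (R : rcfType) (e : R[i]) :
  0 < e -> exists2 r : R, 0 < r & e = (r%:C)%C.
Proof.
move=> e0; have eE := RRe_real (gtr0_real e0).
by exists (complex.Re e); rewrite // -ltcR eE.
Qed.

Section HilbertSpace.
Variables (R : realType) (H : hilbertType R).
Local Notation C := R[i].
Implicit Types (u v x y : H) (a : C).

Lemma innerDl u v x : '[u + v, x] = '[u, x] + '[v, x].
Proof. exact: linearDl. Qed.
Lemma innerBl u v x : '[u - v, x] = '[u, x] - '[v, x].
Proof. exact: linearBl. Qed.
Lemma innerZl a u x : '[a *: u, x] = a * '[u, x].
Proof. exact: linearZl_LR. Qed.
Lemma innerDr u v x : '[x, u + v] = '[x, u] + '[x, v].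
Proof. exact: linearDr. Qed.
Lemma innerBr u v x : '[x, u - v] = '[x, u] - '[x, v].
Proof. exact: linearBr. Qed.
Lemma innerZr a u x : '[x, a *: u] = a^* * '[x, u].
Proof. exact: linearZr_LR. Qed.
Lemma inner_conj u v : '[u, v] = '[v, u]^*.
Proof. exact: dot_conj. Qed.
Lemma inner0l x : '[0, x] = 0. Proof. exact: linear0l. Qed.
Lemma inner0r x : '[x, 0] = 0. Proof. exact: linear0r. Qed.
Definition innerE :=
  (innerBl, innerBr, innerDl, innerDr, innerZl, innerZr, inner0l, inner0r).

Lemma norm_inner_le u v : `|'[u, v]| <= `|u| * `|v|.
Proof. by rewrite !normE; exact: dot_CauchySchwarz. Qed.

Lemma inner_self_eq0 u : '[u, u] = 0 -> u = 0.
Proof. by move=> uu; apply/eqP; rewrite -normr_eq0 normE uu sqrtC0. Qed.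

Lemma parallelogram u v :
  `|u - v| ^+ 2 = 2 * `|u| ^+ 2 + 2 * `|v| ^+ 2 - `|u + v| ^+ 2.
Proof. by rewrite !sqr_normE !innerE; ring. Qed.

(** Take [t] to be the minimizer ['[w, x] / |x|^2]. When [d] is a squared distance that [w] nearly
    attains, the bound makes [w] nearly orthogonal to [x]. *)
Lemma best_approximation (d : C) (w x : H) :
  (forall t, d <= `|w - t *: x| ^+ 2) ->
  `|'[w, x]| ^+ 2 <= (`|w| ^+ 2 - d) * `|x| ^+ 2.
Proof.
move=> dw; have [->|x0] := eqVneq x 0.
  by rewrite inner0r !normr0 expr0n mulr0.
have x2 : 0 < `|x| ^+ 2 by rewrite exprn_gt0// normr_gt0.
have xx0 : '[x, x] != 0 by rewrite -sqr_normE gt_eqF.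
rewrite -ler_pdivrMr// lerBrDr -lerBrDl.
apply: le_trans (dw ('[w, x] / `|x| ^+ 2)) _.
rewrite !sqr_normE !innerE (inner_conj x w) rmorphM fmorphV /= -(inner_conj x
  x).
rewrite normCK le_eqVlt; apply/orP; left; apply/eqP.
by field; exact: xx0.
Qed.

(** A minimizing sequence for the distance from [h] to [M] is Cauchy by the parallelogram law, and
    its limit inherits orthogonality from [best_approximation]. *)
Lemma projection (M : set H) (h : H) : M 0 ->
  (forall a x y, M x -> M y -> M (a *: x + y)) ->
  (forall (u : nat -> H) l, (forall n, M (u n)) -> u @ \oo --> l -> M l) ->
  exists2 m, M m & forall x, M x -> '[x, h - m] = 0.
Proof.
move=> M0 Mlin Mcl.
(* Squared norms are moved from [R[i]] to [R], where infima exist. *)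
pose q x : R := complex.Re (`|x| ^+ 2).
have qE x : `|x| ^+ 2 = ((q x)%:C)%C by rewrite RRe_real// realX// normr_real.
have q_ge0 x : 0 <= q x by rewrite -ler0c -qE exprn_ge0.
pose E := [set q (h - x) | x in M].
have Einf : has_inf E by split; [exists (q (h - 0)), 0|exists 0 => _ [x _ <-]].
have leE x : M x -> inf E <= q (h - x).
  by move=> Mx; apply: ge_inf; [exact: Einf.2|exists x].
have /choice[u uP] n : exists x, M x /\ q (h - x) < inf E + n.+1%:R^-1.
  have [|_ [x Mx <-] lt] := @inf_adherent _ E n.+1%:R^-1 _ Einf; first by [].
  by exists x.
have uu n k : q (u n - u k) <= 2 * n.+1%:R^-1 + 2 * k.+1%:R^-1.
  have [Mn ltn] := uP n; have [Mk ltk] := uP k.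
  (* The midpoint lies in [M], so its squared distance to [h] is at least [inf E]; the parallelogram
     law then bounds [u n - u k]. *)
  have Mh : M (2^-1 *: u n + 2^-1 *: u k).
    by apply: (Mlin) => //; rewrite -[_ *: _]addr0; exact: Mlin.
  have := leE _ Mh.
  have -> : q (u n - u k) = 2 * q (h - u n) + 2 * q (h - u k) -
     4 * q (h - (2^-1 *: u n + 2^-1 *: u k)).
    apply: complexI; rewrite rmorphB rmorphD !rmorphM /= -!qE !rmorph_nat.
    have -> : u n - u k = (h - u k) - (h - u n).
      by rewrite opprB [RHS]addrC addrA subrK.
    rewrite parallelogram; congr (_ - _); first exact: addrC.
    have -> : h - u k + (h - u n) = 2 *: (h - (2^-1 *: u n + 2^-1 *: u k)).
      rewrite scalerBr scalerDr !scalerA divff ?pnatr_eq0// !scale1r.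
      by rewrite scaler_nat mulr2n addrACA -opprD [u k + _]addrC.
    by rewrite normrZ exprMn normr_nat -natrX.
  move: ltn ltk; move: (n.+1%:R^-1) (k.+1%:R^-1) => a b *; lra.
have q_lt x (r : R) : 0 < r -> q x < r ^+ 2 -> `|x| < (r%:C)%C.
  move=> r0 qx; rewrite -(@ltr_pXn2r _ 2%N) ?nnegrE ?normr_ge0 ?ler0c ?(ltW
    r0)//.
  by rewrite qE -rmorphXn /= ltcR.
have : cvg (u @ \oo).
  apply/cauchy_cvgP/cauchy_exP => _ /gt0_complexP[r r0 ->].
  have r2 : 0 < r ^+ 2 / 4 by rewrite divr_gt0// exprn_gt0.
  have [N _ NP] := near_infty_natSinv_lt (PosNum r2).
  exists (u N); exists N => // n /= Nn.
  rewrite -ball_normE /=; apply: q_lt => //.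
  apply: le_lt_trans (uu _ _) _.
  have := NP _ Nn; have := NP _ (leqnn N) => /=.
  by move: (n.+1%:R^-1) (N.+1%:R^-1) => a b *; lra.
move=> /cvg_ex[m um]; exists m.
  by apply: (Mcl) um => n; exact: (uP n).1.
move=> x Mx; rewrite inner_conj.
suff -> : '[h - m, x] = 0 by rewrite rmorph0.
apply/eqP; rewrite -normr_eq0; apply/eqP/le_anti; rewrite normr_ge0 andbT.
apply/ler_addgt0Pl => e e0; rewrite addr0.
have x1 : 0 < 1 + `|x| by rewrite ltr_pwDl.
(* The error [e] is shared by [h - u n] (near minimality) and [m - u n] (convergence), each
   contributing at most [r * (1 + |x|)]. *)
have [r r0 rE] : exists2 r : R, 0 < r & e / (2 * (1 + `|x|)) = (r%:C)%C.
  by apply: gt0_complexP; rewrite divr_gt0// mulr_gt0.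
near \oo => n.
have un : `|m - u n| < (r%:C)%C.
  by near: n; move/cvgrPdist_lt : um; apply; rewrite ltcR.
have hn : `|'[h - u n, x]| <= (r%:C)%C * `|x|.
  rewrite -(@ler_pXn2r _ 2%N) ?nnegrE ?mulr_ge0 ?normr_ge0 ?ler0c ?(ltW r0)//.
  apply: le_trans (best_approximation (d := ((inf E)%:C)%C) _) _.
    move=> t; rewrite qE lecR.
    have -> : h - u n - t *: x = h - (t *: x + u n).
      by rewrite opprD addrA addrAC.
    by apply: (leE); apply: (Mlin) => //; exact: (uP n).1.
  rewrite exprMn ler_wpM2r ?exprn_ge0// qE -rmorphB -rmorphXn /= lecR.
  have := (uP n).2.
  have : n.+1%:R^-1 < r ^+ 2.
    by near: n; exact: (near_infty_natSinv_lt (PosNum (exprn_gt0 2 r0))).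
  by move: (n.+1%:R^-1) => a *; lra.
have -> : h - m = (h - u n) - (m - u n) by rewrite opprB addrA subrK.
rewrite innerBl; apply: le_trans (ler_normB _ _) _.
have -> : e = (r%:C)%C * (1 + `|x|) + (r%:C)%C * (1 + `|x|).
  by rewrite -rE; field; rewrite gt_eqF.
apply: lerD; first by apply: le_trans hn _; rewrite ler_pM2l ?ltcR// lerDr.
apply: le_trans (norm_inner_le _ _) _.
by apply: ler_pM => //; [exact: ltW|rewrite lerDr].
Unshelve. all: by end_near.
Qed.

End HilbertSpace.

(** * Symmetric and self-adjoint graphs *)

Section Graphs.
Variables (R : realType) (H : hilbertType R).
Local Notation C := R[i].
Implicit Types (G : set (H * H)) (f h k w : H) (z : C).

Lemma normc_ge_Im z : (`|complex.Im z|%:C)%C <= `|z|.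
Proof.
have -> : complex.Im z = - complex.Re (z * 'i%C) by rewrite ReiNIm opprK.
rewrite normrN; apply: le_trans (normc_ge_Re _) _.
by rewrite normrM complexiE normCi mulr1.
Qed.

Lemma Im_conj z : complex.Im z^* = - complex.Im z.
Proof. by case: z. Qed.

Lemma conj_fix_Im z : z^* = z -> complex.Im z = 0.
Proof. by move=> /(congr1 (@complex.Im R)); rewrite Im_conj; lra. Qed.

(** The imaginary part of ['[k - z *: f, f]] is [Im '[k, f] - Im z * |f|^2], whose two terms cannot
    cancel under the sign hypothesis; Cauchy-Schwarz concludes. This covers symmetric graphs and,
    for [z] in the lower half-plane, dissipative ones. *)
Lemma Im_form_bound f k z : complex.Im '[k, f] * complex.Im z <= 0 ->
  (`|complex.Im z|%:C)%C * `|f| <= `|k - z *: f|.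
Proof.
move=> kf; have [->|f0] := eqVneq f 0; first by rewrite normr0 mulr0.
have f1 : 0 < `|f| by rewrite normr_gt0.
rewrite -(ler_pM2r f1); apply: le_trans (norm_inner_le _ _).
apply: le_trans (normc_ge_Im _);
  rewrite innerBl innerZl -mulrA -expr2 sqr_normE.
have := dot_ge0 inner f; rewrite lecE; move: kf.
case: '[f, f] => a b; case: '[k, f] => c d;
  case: z => e i /= di /andP[/eqP-> a0].
rewrite !mul0r !mulr0 addr0 eqxx subr0 add0r /=.
have [i0|i0] := leP 0 i.
  rewrite (ger0_norm i0); have [d0|d0] := ltP 0 d.
    have -> : i = 0 by nra.
    by rewrite !mul0r.
  by rewrite ler0_norm; nra.
rewrite (ltr0_norm i0); have [d0|d0] := ltP d 0; first by nra.
by rewrite ger0_norm; nra.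
Qed.

Lemma symmetric_Im G p : symmetric_graph G -> G p -> complex.Im '[p.2, p.1] = 0.
Proof.
by move=> Gs Gp; apply: conj_fix_Im; rewrite -inner_conj -(Gs _ Gp _ Gp).
Qed.

Lemma symmetric_eigenvector G f z : symmetric_graph G ->
  complex.Im z != 0 -> G (f, z *: f) -> f = 0.
Proof.
move=> Gs z0 Gf; have := @Im_form_bound f (z *: f) z.
rewrite (symmetric_Im Gs Gf) mul0r subrr normr0 => /(_ (lexx _)).
rewrite pmulr_rle0 ?normr_le0; first by move/eqP.
by rewrite ltcR normr_gt0.
Qed.

(** The lower bound makes the range of [G - z] closed, and the component of [h] orthogonal to this
    range is an eigenvector of the adjoint at [z^*], or zero. *)
Lemma range_decomposition G (c z : C) : G 0 ->
  (forall a p q, G p -> G q -> G (a *: p + q)) -> closed G -> 0 < c ->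
  (forall p, G p -> c * `|p.1| <= `|p.2 - z *: p.1|) ->
  forall h, exists p w,
    [/\ G p, adjoint G (w, z^* *: w) & h = p.2 - z *: p.1 + w].
Proof.
move=> G0 Glin Gcl c0 Gc h.
have [||u l uM ul|_ [p Gp <-] mP] :=
    @projection _ _ [set p.2 - z *: p.1 | p in G] h.
- by exists 0 => //=; rewrite scaler0 subr0.
- move=> a _ _ [p Gp <-] [q Gq <-]; exists (a *: p + q); first exact: Glin.
  by rewrite /= scalerDr scalerBr opprD addrACA !scalerA mulrC.
- have /choice[p pP] n : exists p, G p /\ p.2 - z *: p.1 = u n.
    by have [p Gp <-] := uM n; exists p.
  (* The images [u n] converge, and the bound by [c] carries the Cauchy property back to the first
     components. *)
  have : cvg ((fun n => (p n).1) @ \oo).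
    apply/cauchy_cvgP/cauchy_exP => e e0.
    have ce : 0 < c * e / 2 by rewrite divr_gt0// mulr_gt0.
    have [N _ NP] : \forall n \near \oo, `|l - u n| < c * e / 2.
      by move/cvgrPdist_lt : ul; apply.
    exists (p N).1; exists N => // n /= Nn; rewrite -ball_normE /=.
    rewrite -(ltr_pM2l c0).
    have := Gc _ (Glin (-1) _ _ (pP n).1 (pP N).1).
    rewrite /= !scaleN1r [- _ + _]addrC => /le_lt_trans; apply.
    have -> : - (p n).2 + (p N).2 - z *: ((p N).1 - (p n).1) =
        (l - u n) - (l - u N).
      rewrite -(pP n).2 -(pP N).2 scalerBr !opprB.
      rewrite [RHS]addrC -[RHS]addrA [in RHS](addrC (- l)) [in RHS](addrC l).
      by rewrite addrK (addrC (- _)) addrACA [RHS]addrACA; congr (_ + _);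
        rewrite addrC.
    apply: le_lt_trans (ler_normB _ _) _.
    have -> : c * e = c * e / 2 + c * e / 2 by field.
    by apply: ltrD; apply: NP => //=.
  move=> /cvg_ex[f pf].
  have pl : (fun n => (p n).2) @ \oo --> l + z *: f.
    rewrite (_ : (fun n => _) = (fun n => u n + z *: (p n).1)); last first.
      by apply/funext => n; rewrite -(pP n).2 subrK.
    by apply: cvgD => //; apply: cvgZr.
  exists (f, l + z *: f); last by rewrite /= addrK.
  have := @closed_cvg _ _ \oo _ (fun n => ((p n).1, (p n).2)) G Gcl.
  apply; last exact: cvg_pair.
  by near=> n; rewrite -surjective_pairing; exact: (pP n).1.
exists p, (h - (p.2 - z *: p.1)); split=> //; last by rewrite addrC subrK.
move=> q Gq /=; rewrite innerZr conjCK; apply/eqP; rewrite -subr_eq0.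
by rewrite -innerZl -innerBl mP//; exists q.
Unshelve. all: by end_near.
Qed.

Lemma adjoint_closed G : closed (adjoint G).
Proof.
have inner_cont (x : H) : continuous (fun y : H => '[y, x] : C^o).
  move=> y; apply/cvgrPdist_lt => e e0.
  have x1 : 0 < `|x| + 1 by rewrite ltr_wpDl.
  near=> t; rewrite -innerBl; apply: le_lt_trans (norm_inner_le _ _) _.
  apply: (@le_lt_trans _ _ (`|y - t| * (`|x| + 1))).
    by rewrite ler_wpM2l// lerDl.
  rewrite -ltr_pdivlMr//; near: t.
  by apply: (@cvgr_dist_lt _ _ _ _ _ id y cvg_id); rewrite divr_gt0.
(* The defining equations are conjugated so that [p] enters through the first argument of the inner
   product, where continuity has just been shown. *)
rewrite (_ : adjoint G =
  \bigcap_(q in G) [set p | '[p.1, q.2] - '[p.2, q.1] = 0 :> C]).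
  apply: closed_bigI => q _.
  apply: (@preimage_closed _ _
    (fun p : H * H => '[p.1, q.2] - '[p.2, q.1] : C^o) [set 0]).
    move=> p _; apply: cvgB.
    - by apply: (@continuous_comp _ _ _ fst (fun y => '[y, q.2] : C^o));
      [exact: cvg_fst|exact: inner_cont].
    - by apply: (@continuous_comp _ _ _ snd (fun y => '[y, q.1] : C^o));
      [exact: cvg_snd|exact: inner_cont].
  exact: (accessible_closed_set1 (hausdorff_accessible (@norm_hausdorff _
    C^o))).
apply/seteqP; split=> [p Gp q Gq|p Gp q Gq] /=.
  by rewrite (inner_conj p.1) (inner_conj p.2) Gp// subrr.
have /= /eqP := Gp q Gq; rewrite subr_eq0 => /eqP pq.
by rewrite (inner_conj q.2) (inner_conj q.1) pq.
Unshelve. all: by end_near.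
Qed.

Lemma adjoint0 G : adjoint G 0.
Proof. by move=> q _ /=; rewrite !inner0r. Qed.

(** The range of [G - z] is closed, and a nonzero vector orthogonal to it would be an eigenvector of
    [G] at the nonreal [z^*]. *)
Lemma self_adjoint_onto G z h : self_adjoint G -> complex.Im z != 0 ->
  exists f, G (f, h + z *: f).
Proof.
move=> GA z0; have Gs : symmetric_graph G by rewrite /symmetric_graph GA.
have [||||p Gp|p [w [Gp Gw ->]]] := @range_decomposition G
    (`|complex.Im z|%:C)%C z _ _ _ _ _ h.
- by rewrite -GA; exact: adjoint0.
- by move=> a p q; rewrite -GA; exact: adjoint_linear.
- by rewrite -GA; exact: adjoint_closed.
- by rewrite ltcR normr_gt0.
- by apply: Im_form_bound; rewrite (symmetric_Im Gs Gp) mul0r.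
suff -> : w = 0 by exists p.1; rewrite addr0 subrK -surjective_pairing.
apply: (symmetric_eigenvector Gs (z := z^*)); last by rewrite -GA.
by rewrite Im_conj oppr_eq0.
Qed.
End Graphs.

(** * Resolvent of a self-adjoint graph *)

Lemma ImD (R : rcfType) (a b : R[i]) :
  complex.Im (a + b) = complex.Im a + complex.Im b.
Proof. by case: a b => [? ?] [? ?]. Qed.

Section Resolvent.
Variables (R : realType) (H : hilbertType R) (G : set (H * H)).
Local Notation C := R[i].
Hypothesis GA : self_adjoint G.
Implicit Types (f h k : H) (z w : C).

Let Gs : symmetric_graph G. Proof. by rewrite /symmetric_graph GA. Qed.

Lemma resolventP z h : complex.Im z != 0 ->
  G (resolvent G z h, h + z *: resolvent G z h).
Proof.
move=> z0; rewrite /resolvent; case: xgetP => [f _ [k Gk <-]|none].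
  by rewrite subrK.
have [f Gf] := self_adjoint_onto h GA z0.
by have := none f; case; exists (h + z *: f) => //; rewrite addrK.
Qed.

Lemma resolvent_unique z f h : complex.Im z != 0 ->
  G (f, h + z *: f) -> resolvent G z h = f.
Proof.
move=> z0 Gf; apply/eqP; rewrite -subr_eq0; apply/eqP.
apply: (symmetric_eigenvector Gs z0).
move: Gf (resolventP h z0); rewrite -GA => Gf Gr.
have := adjoint_linear (-1) Gf Gr; congr (adjoint G _).
rewrite !scaleN1r; congr (_, _); rewrite /= addrC//.
by rewrite opprD addrACA subrr add0r scalerBr.
Qed.

Lemma resolvent_bound z h : complex.Im z != 0 ->
  `|resolvent G z h| <= `|h| / (`|complex.Im z|%:C)%C.
Proof.
move=> z0; have Gr := resolventP h z0.
rewrite ler_pdivlMr ?ltcR ?normr_gt0// mulrC.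
have := @Im_form_bound _ _ (resolvent G z h) (h + z *: resolvent G z h) z.
by rewrite addrK; apply; rewrite (symmetric_Im Gs Gr) mul0r.
Qed.

Lemma resolvent_identity z w h : complex.Im z != 0 -> complex.Im w != 0 ->
  resolvent G w h - resolvent G z h =
    (w - z) *: resolvent G w (resolvent G z h).
Proof.
move=> z0 w0; apply/eqP; rewrite subr_eq; apply/eqP.
apply: resolvent_unique => //.
move: (resolventP h z0) (resolventP (resolvent G z h) w0).
rewrite -GA => Gz Gw; have := adjoint_linear (w - z) Gw Gz; congr (adjoint G _).
congr (_, _) => /=; rewrite addrCA; congr (_ + _).
rewrite !scalerDr !scalerA [w * _]mulrC addrAC scalerBl.
by rewrite subrK addrC.
Qed.

Lemma resolvent_adjoint z h k : complex.Im z != 0 ->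
  '[resolvent G z h, k] = '[h, resolvent G z^* k].
Proof.
move=> z0; have z0' : complex.Im z^* != 0 by rewrite Im_conj oppr_eq0.
have /= := Gs (resolventP k z0') (resolventP h z0).
by rewrite !innerE conjCK => /addIr.
Qed.

(** The resolvent identity turns the difference quotient into the inner product of [r] with the
    resolvent at the conjugate of [h + z]; a second use of the identity shows convergence to
    ['[r, r']]. *)
Lemma resolvent_derivable z g : complex.Im z != 0 ->
  derivable ((fun w : C => '[resolvent G w g, g]) : C^o -> C^o) z 1.
Proof.
move=> z0; have z0' : complex.Im z^* != 0 by rewrite Im_conj oppr_eq0.
have i0 : 0 < `|complex.Im z| by rewrite normr_gt0.
set r := resolvent G z g; set r' := resolvent G z^* g.
apply/cvg_ex; exists '[r, r'].
(* Within distance [c] of [z] the imaginary part keeps modulus at least [c], so the resolvents there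
   are uniformly bounded by [1 / c]. *)
pose c : C := ((`|complex.Im z| / 2)%:C)%C.
have c0 : 0 < c by rewrite ltcR divr_gt0.
apply/cvgrPdist_lt => e e0.
(* The summand [1] keeps [b] positive when [r] or [r'] vanishes. *)
pose b := `|r| * (`|r'| / c) + 1.
have b0 : 0 < b.
  by rewrite /b ltr_wpDl// !mulr_ge0// invr_ge0 ltW.
near=> h => /=; have h0 : h != 0 by near: h; exact: nbhs_dnbhs_neq.
have hc : `|h| < c.
  near: h; apply: dnbhs0_lt => //.
have hb : `|h| < e / b by near: h; apply: dnbhs0_lt => //; rewrite divr_gt0.
have wc : `|complex.Im z| / 2 <= `|complex.Im (h + z)|.
  have : `|complex.Im h| <= `|complex.Im z| / 2.
    by rewrite -lecR; apply: le_trans (ltW hc); exact: normc_ge_Im.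
  rewrite ImD.
  by have := lerB_normD (complex.Im z) (complex.Im h);
    rewrite [_ + complex.Im z]addrC; lra.
have w0 : complex.Im (h + z) != 0.
  by rewrite -normr_gt0; apply: lt_le_trans wc; rewrite divr_gt0.
have w0' : complex.Im (h + z)^* != 0 by rewrite Im_conj oppr_eq0.
have -> : h *: (1 : C^o) + z = (h + z : C) by rewrite [h *: _]mulr1.
have -> : h^-1 *: ('[resolvent G (h + z) g, g] - '[r, g] : C^o) =
          '[r, resolvent G (h + z)^* g].
  rewrite -innerBl resolvent_identity// addrK innerZl resolvent_adjoint//.
  by rewrite [_ *: _]mulKf.
rewrite -innerBr; apply: le_lt_trans (norm_inner_le _ _) _.
rewrite distrC resolvent_identity// -rmorphB addrK normrZ norm_conjC.
have rb : `|resolvent G (h + z)^* r'| <= `|r'| / c.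
  apply: le_trans (resolvent_bound _ w0') _.
  rewrite ler_wpM2l// lef_pV2 ?posrE//; last by rewrite ltcR normr_gt0.
  by rewrite Im_conj normrN lecR.
apply: (@le_lt_trans _ _ (`|h| * b)).
  rewrite mulrCA ler_wpM2l// /b; apply: (@le_trans _ _ (`|r| * (`|r'| / c))).
    by rewrite ler_wpM2l.
  by rewrite lerDl.
by rewrite -ltr_pdivlMr.
Unshelve. all: by end_near.
Qed.

(** [G] sends [resolvent G z g] to [g + z *: resolvent G z g]. In the resulting form the factor
    [z ^+ 2 + 1] makes the value at ['i] explicit. *)
Lemma weyl_titchmarshE g z :
  (forall f h k, G (f, h) -> G (f, k) -> h = k) -> complex.Im z != 0 ->
  weyl_titchmarsh G g z =
    z * '[g, g] + (z ^+ 2 + 1) * '[resolvent G z g, g].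
Proof.
move=> Gfun z0; have Gr := resolventP g z0.
rewrite /weyl_titchmarsh (_ : app G _ = g + z *: resolvent G z g).
  by rewrite !innerE; ring.
have ex : [set k | G (resolvent G z g, k)] !=set0.
  by exists (g + z *: resolvent G z g).
exact: (Gfun _ _ _ (xgetPex 0 ex) Gr).
Qed.

End Resolvent.

(** * Von Neumann's decomposition and the boundary form *)

Lemma addrr_half (F : numFieldType) (x : F) : x + x = 1 -> x = 2^-1.
Proof.
move=> xx; apply: (@mulfI _ 2); first by rewrite pnatr_eq0.
by rewrite divff ?pnatr_eq0// mulr_natl mulr2n.
Qed.

Section Boundary.
Variables (R : realType) (H : hilbertType R) (Adot : symmetric_operator H).
Local Notation C := R[i].
Implicit Types f h : hplus Adot.

Lemma conjN'i : (- 'i : C)^* = 'i.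
Proof. by rewrite rmorphN /= conjCi opprK. Qed.

Lemma Im_i : complex.Im ('i : C) = 1. Proof. by rewrite -complexiE. Qed.

Lemma ii : 'i * 'i = -1 :> C. Proof. by rewrite -expr2 sqrCi. Qed.

(* ring and field see 'i as an indeterminate; k is the cofactor of 'i ^+ 2 + 1. *)
Lemma eq_mod_i (x y k : C) : x - y = ('i * 'i + 1) * k -> x = y.
Proof. by rewrite ii addNr mul0r => /eqP; rewrite subr_eq0 => /eqP. Qed.

(* Turns vector identities, for which no tactic is available, into scalar ones. *)
Lemma inner_ext (u v : H) : (forall x, '[u, x] = '[v, x]) -> u = v.
Proof.
move=> uv; apply/eqP; rewrite -subr_eq0; apply/eqP/inner_self_eq0.
by rewrite innerBl uv subrr.
Qed.

Lemma Astar_lift x y : adjoint Adot (x, y) ->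
  exists f : hplus Adot, hval f = x /\ Astar f = y.
Proof.
move=> xy; have fP : x \in dom_adjoint Adot by apply/asboolP; exists y.
by exists (Hplus fP); split=> //; exact: (AstarE (f := Hplus fP)).
Qed.

Lemma Adot_lift x y : graph Adot (x, y) ->
  exists f : hplus Adot, hval f = x /\ Astar f = y.
Proof. by move=> /(@sym_symmetric _ _ Adot)/Astar_lift. Qed.

Lemma AstarD f h : Astar (f + h) = Astar f + Astar h.
Proof. exact: linearD. Qed.
Lemma AstarB f h : Astar (f - h) = Astar f - Astar h.
Proof. exact: linearB. Qed.
Lemma AstarZ a f : Astar (a *: f) = a *: Astar f.
Proof. exact: linearZ. Qed.
Lemma hvalD f h : hval (f + h) = hval f + hval h. Proof. by []. Qed.
Lemma hvalB f h : hval (f - h) = hval f - hval h. Proof. by []. Qed.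
Lemma hvalZ a f : hval (a *: f) = a *: hval f. Proof. by []. Qed.
Definition hplusE := (hvalB, hvalD, hvalZ, AstarB, AstarD, AstarZ).
Lemma inner_plusD f h k :
  inner_plus (f + h) k = inner_plus f k + inner_plus h k.
Proof. by rewrite /inner_plus !hplusE !innerE addrACA. Qed.
Lemma inner_plusB f h k :
  inner_plus (f - h) k = inner_plus f k - inner_plus h k.
Proof. by rewrite /inner_plus !hplusE !innerE; ring. Qed.
Lemma inner_plusZ a f k : inner_plus (a *: f) k = a * inner_plus f k.
Proof. by rewrite /inner_plus !hplusE !innerE mulrDr. Qed.

Lemma inner_plus_deficiency z f h : Astar h = z *: hval h ->
  inner_plus f h = '[hval f + z^* *: Astar f, hval h].
Proof. by move=> hz; rewrite /inner_plus hz !innerE. Qed.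

Lemma Adot_symm f (k : hplus Adot) : graph Adot (hval f, Astar f) ->
  '[Astar f, hval k] = '[hval f, Astar k].
Proof. by move=> Af; rewrite (AstarP k Af). Qed.

Lemma Adot_deficiency z f h :
  z * z^* = 1 -> z ^+ 2 = -1 -> Astar h = z *: hval h ->
  graph Adot (hval f, Astar f) -> inner_plus f h = 0.
Proof.
move=> zz z2 hz Af; rewrite (inner_plus_deficiency _ hz) innerDl innerZl.
rewrite (AstarP h Af) hz /= innerZr mulrA -rmorphM/= -expr2 z2.
by rewrite rmorphN rmorph1 mulN1r subrr.
Qed.

Variables (gp gm : hplus Adot).
Hypothesis indices : deficiency_indices_1_1 Adot.
Hypothesis gp_def : deficiency_space Adot 'i (hval gp).
Hypothesis gm_def : deficiency_space Adot (- 'i) (hval gm).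
Hypothesis gp_norm : norm_plus gp = 1.
Hypothesis gm_norm : norm_plus gm = 1.

Lemma Astar_gp : Astar gp = 'i *: hval gp. Proof. exact: AstarE. Qed.
Lemma Astar_gm : Astar gm = - 'i *: hval gm. Proof. exact: AstarE. Qed.

Lemma inner_plus_gpp : inner_plus gp gp = 1.
Proof. by rewrite -[LHS]sqrtCK -/(norm_plus gp) gp_norm expr1n. Qed.
Lemma inner_plus_gmm : inner_plus gm gm = 1.
Proof. by rewrite -[LHS]sqrtCK -/(norm_plus gm) gm_norm expr1n. Qed.

Lemma inner_gpp : '[hval gp, hval gp] = 2^-1.
Proof.
have := inner_plus_gpp;
  rewrite /inner_plus Astar_gp !innerE mulrA -normCK normCi.
by rewrite expr1n mul1r; exact: addrr_half.
Qed.
Lemma inner_gmm : '[hval gm, hval gm] = 2^-1.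
Proof.
have := inner_plus_gmm;
  rewrite /inner_plus Astar_gm !innerE mulrA -normCK normrN normCi.
by rewrite expr1n mul1r; exact: addrr_half.
Qed.

Lemma inner_plus_gpm : inner_plus gp gm = 0.
Proof.
rewrite (inner_plus_deficiency _ Astar_gm) Astar_gp !innerE mulrA rmorphN /=
  conjCi.
by rewrite opprK -expr2 sqrCi mulN1r subrr.
Qed.
Lemma inner_plus_gmp : inner_plus gm gp = 0.
Proof.
rewrite (inner_plus_deficiency _ Astar_gp) Astar_gm !innerE mulrA conjCi.
by rewrite mulrNN -expr2 sqrCi mulN1r subrr.
Qed.

Lemma Adot_gp f : graph Adot (hval f, Astar f) -> inner_plus f gp = 0.
Proof.
by apply: (Adot_deficiency (z := 'i));
  rewrite ?sqrCi ?Astar_gp// conjCi mulrN -expr2 sqrCi opprK.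
Qed.
Lemma Adot_gm f : graph Adot (hval f, Astar f) -> inner_plus f gm = 0.
Proof.
apply: (Adot_deficiency (z := - 'i)); rewrite ?sqrrN ?sqrCi ?Astar_gm//.
by rewrite conjN'i mulNr ii opprK.
Qed.

Lemma dimension_one_span (E : set H) x y :
  dimension_one E -> E x -> x != 0 -> E y -> exists c : C, y = c *: x.
Proof.
move=> [e e0 ->] [a _ ax] x0 [b _ <-]; exists (b / a).
rewrite -ax scalerA divfK//; apply: contra_neq x0 => a0.
by rewrite -ax a0 scale0r.
Qed.

Lemma gp_neq0 : hval gp != 0.
Proof.
apply/eqP => g0; have := inner_gpp; rewrite g0 inner0l => /esym/eqP.
by rewrite invr_eq0 pnatr_eq0.
Qed.
Lemma gm_neq0 : hval gm != 0.
Proof.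
apply/eqP => g0; have := inner_gmm; rewrite g0 inner0l => /esym/eqP.
by rewrite invr_eq0 pnatr_eq0.
Qed.

Lemma gp_span x : deficiency_space Adot 'i x -> exists c : C, x = c *: hval gp.
Proof. exact: dimension_one_span indices.1 gp_def gp_neq0. Qed.
Lemma gm_span x :
  deficiency_space Adot (- 'i) x -> exists c : C, x = c *: hval gm.
Proof. exact: dimension_one_span indices.2 gm_def gm_neq0. Qed.

(** The range of [Adot + i] is closed, with orthogonal complement [Ker (S - i)], which [gp]
    spans. *)
Lemma range_Adot x : exists p (c : C),
  graph Adot p /\ x = p.2 + 'i *: p.1 + c *: hval gp.
Proof.
have [||||p Ap|p [w [Ap Aw ->]]] := @range_decomposition _ _ Adot 1 (- 'i) _ _
  _ _ _ x.
- exact: graph0.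
- by move=> *; exact: graph_linear.
- exact: sym_closed.
- exact: ltr01.
- have := @Im_form_bound _ _ p.1 p.2 (- 'i).
  rewrite (symmetric_Im (@sym_symmetric _ _ Adot) Ap) mul0r lexx -conjCi
    Im_conj Im_i normrN1.
  exact.
move: Aw; rewrite conjN'i => /gp_span[c ->]; exists p, c; split=> //.
by rewrite scaleNr opprK.
Qed.

Lemma von_Neumann_decomposition f : exists f0 : hplus Adot,
  graph Adot (hval f0, Astar f0) /\
  f = f0 + inner_plus f gp *: gp + inner_plus f gm *: gm.
Proof.
have [p [c [Ap fE]]] := range_Adot (Astar f + 'i *: hval f).
have [f0 [f0p f0A]] : exists f0 : hplus Adot, hval f0 = p.1 /\ Astar f0 = p.2.
  by apply: Adot_lift; rewrite -surjective_pairing.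
have Af0 : graph Adot (hval f0, Astar f0) by rewrite f0p f0A
  -surjective_pairing.
(* As [(S + i) gp = 2i gp], adding [- c / (2i)] times [gp] to [f - f0] leaves a vector of
   [Ker (S + i)]. *)
pose d := f - f0 + (2^-1 * 'i * c) *: gp.
have [e de] : exists e, hval d = e *: hval gm.
  apply: gm_span; have := AstarP d; congr (adjoint _ (_, _)).
  apply: inner_ext => x; have := congr1 (inner^~ x) fE.
  rewrite /d !hplusE Astar_gp f0p f0A !innerE => fx.
  have -> : '[Astar f, x] =
      '[p.2, x] + 'i * '[p.1, x] + c * '[hval gp, x] - 'i * '[hval f, x].
    by rewrite -fx addrK.
  by apply: (eq_mod_i (k := c * '[hval gp, x])); field.
have fE' : f = f0 - (2^-1 * 'i * c) *: gp + e *: gm.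
  apply: val_inj; rewrite /= -de; apply: inner_ext => x.
  by rewrite /d !hplusE !innerE; ring.
exists f0; split=> //.
have -> : inner_plus f gp = - (2^-1 * 'i * c).
  rewrite fE' inner_plusD inner_plusB !inner_plusZ inner_plus_gpp
    inner_plus_gmp.
  by rewrite Adot_gp// mulr1 mulr0 addr0 sub0r.
have -> : inner_plus f gm = e.
  rewrite fE' inner_plusD inner_plusB !inner_plusZ inner_plus_gpm
    inner_plus_gmm.
  by rewrite Adot_gm// mulr1 mulr0 subr0 add0r.
by rewrite scaleNr.
Qed.

(** Terms with an [Adot] component cancel by symmetry, and so do the cross terms of [gp] and [gm].
    The diagonal terms contribute [i] and [- i] because [gp] and [gm] have squared norm one half in
    [H]. *)
Lemma boundary_form f h : '[Astar f, hval h] - '[hval f, Astar h] =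
  'i * (inner_plus f gp * (inner_plus h gp)^* -
        inner_plus f gm * (inner_plus h gm)^*).
Proof.
have [f0 [Af0 fE]] := von_Neumann_decomposition f.
have [h0 [Ah0 hE]] := von_Neumann_decomposition h.
move: fE hE; set a := inner_plus f gp; set b := inner_plus f gm.
set a' := inner_plus h gp; set b' := inner_plus h gm => fE hE.
have f0h k := Adot_symm k Af0.
have h0f (k : hplus Adot) : '[hval k, Astar h0] = '[Astar k, hval h0].
  by rewrite inner_conj [RHS]inner_conj (Adot_symm k Ah0).
rewrite {1}fE {1}fE !hplusE 2!innerDl f0h.
rewrite [X in _ - X]innerDl [X in _ - (X + _)]innerDl.
rewrite opprD opprD !addrA.
rewrite !innerZl hE !hplusE !innerDr !h0f Astar_gp Astar_gm !innerE.
rewrite conjN'i conjCi inner_gpp inner_gmm.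
set u := '[hval gp, hval gm]; set u' := '[hval gm, hval gp].
by field.
Qed.

Lemma Adot_of_coeff f : inner_plus f gp = 0 -> inner_plus f gm = 0 ->
  graph Adot (hval f, Astar f).
Proof.
have [f0 [Af0 fE]] := von_Neumann_decomposition f => a0 b0.
by rewrite fE a0 b0 !scale0r !addr0.
Qed.

(* The coordinates of f along gp and gm in von Neumann's decomposition. *)
Local Notation a f := (inner_plus f gp).
Local Notation b f := (inner_plus f gm).

(** * Elements of [H_-] and operators from [H_+] to [H_-] *)

Lemma hminus_ext (u v : hminus Adot) : (forall f, u f = v f) -> u = v.
Proof. by move=> uv; apply/val_inj/funext. Qed.

Lemma embedE x f : embed Adot x f = '[x, hval f]. Proof. by []. Qed.
Lemma hminusDE (u v : hminus Adot) f : (u + v) f = u f + v f.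
Proof. by []. Qed.
Lemma hminusBE (u v : hminus Adot) f : (u - v) f = u f - v f.
Proof. by []. Qed.
Lemma hminusZE k (u : hminus Adot) f : (k *: u) f = k * u f.
Proof. by []. Qed.
Lemma riesz_inv_conj h f : riesz_inv h f = (inner_plus f h)^*.
Proof. exact: (dot_conj (@inner_plus _ _ Adot)). Qed.
Lemma pairing_riesz f h : pairing f (riesz_inv h) = inner_plus f h.
Proof. exact: riesz_invE. Qed.
Definition hminusE := (hminusBE, hminusDE, hminusZE, embedE, riesz_inv_conj).

Lemma bop_adjE (B : bop Adot) f h : bop_adj B f h = (B h f)^*.
Proof. by []. Qed.
Lemma bop_reE (B : bop Adot) f h :
  bop_re B f h = 2^-1 * (B f h + (B h f)^*).
Proof. by []. Qed.
Lemma bop_imE (B : bop Adot) f h :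
  bop_im B f h = (2 * 'i)^-1 * (B f h - (B h f)^*).
Proof. by []. Qed.

Lemma bop_linear (B : bop Adot) k f h : B (k *: f + h) = k *: B f + B h.
Proof. by have /asboolP[Bl _] := bopP B; exact: Bl. Qed.

Definition perturbation_fun (u v : hminus Adot) : hplus Adot -> hminus Adot :=
  fun f => embed Adot (Astar f) - ('i * pairing f u) *: v.

Lemma perturbation_subproof u v : perturbation_fun u v \in @bop_pred _ _ Adot.
Proof.
have pairingE k f h : pairing (k *: f + h) u = k * pairing f u + pairing h u.
  by rewrite /pairing hminus_antilinear rmorphD rmorphM /= conjCK.
apply/asboolP; split=> [k f h|].
  apply: hminus_ext => g;
    rewrite /perturbation_fun !hminusE pairingE AstarD AstarZ !innerE.
  by ring.
have [M uM] := hminus_bounded u; have [N vN] := hminus_bounded v.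
exists (1 + M * N) => f h; rewrite /perturbation_fun !hminusE.
apply: le_trans (ler_normB _ _) _; rewrite mulrDl mulrDl; apply: lerD.
  apply: le_trans (norm_inner_le _ _) _; rewrite mul1r; apply: ler_pM => //.
    rewrite normE ler_sqrtC ?nnegrE ?dot_ge0//; by rewrite lerDr dot_ge0.
  exact: norm_le_plus.
rewrite !normrM normCi mul1r norm_conjC.
rewrite [leRHS](_ : _ = (M * norm_plus f) * (N * norm_plus h)); last by ring.
by apply: ler_pM.
Qed.

Definition perturbation u v : bop Adot := Bop (perturbation_subproof u v).

Definition scale_channel (u : hminus Adot) : C^o -> hminus Adot :=
  fun c => c *: u.
Lemma scale_channel_is_linear u : linear (scale_channel u).
Proof. by move=> k c d; rewrite /scale_channel scalerDl scalerA. Qed.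
HB.instance Definition _ u := GRing.isLinear.Build C C^o (hminus Adot) _
  (scale_channel u) (scale_channel_is_linear u).

Lemma Im_Astar f :
  ((complex.Im '[Astar f, hval f])%:C)%C = 2^-1 * (`|a f| ^+ 2 - `|b f| ^+ 2).
Proof.
have := boundary_form f f; rewrite (inner_conj (hval f)) -!normCK.
case: '[Astar f, hval f] => x y.
have -> : (x +i* y)%C - ((x +i* y)%C)^* = 'i * (2 * (y%:C)%C).
  rewrite -complexiE; apply/eqP; rewrite eq_complex /=; apply/andP; split;
    apply/eqP; ring.
by move=> /(mulfI (neq0Ci _)) <- /=; rewrite mulKf// pnatr_eq0.
Qed.

(** Dissipativity bounds [T + i] from below. For surjectivity, the range of [Adot + i] together with
    [gp] spans [H], and [f] supplies the direction [gp]. *)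
Lemma dissipative_resolvent (T : operator H) f : dissipative T ->
  Adot `<=` T -> graph T (hval f, Astar f) -> a f != 0 ->
  resolvent_set T (- 'i).
Proof.
move=> Td AT Tf af0; split; last first.
  exists 1 => p Tp; have := @Im_form_bound _ _ p.1 p.2 (- 'i).
  rewrite -conjCi Im_conj Im_i mulrN1 oppr_le0 normrN1 => /(_ (Td _ Tp)) le.
  by rewrite mul1r; apply: le_trans le; rewrite -[leLHS]mul1r.
move=> h; have [p [c [Ap ->]]] := range_Adot h.
have [f0 [Af0 fE]] := von_Neumann_decomposition f.
(* Since [S + i] kills [gm], it sends [f - f0] to [2i (a f) gp]; the factor [k] rescales this to
   [c gp]. *)
pose k := c / (2 * 'i * a f).
have Tk : graph T (k *: (hval f, Astar f) + (-k *: (hval f0, Astar f0) + p)).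
  apply: graph_linear => //; apply: AT; exact: graph_linear.
exists (k *: (hval f, Astar f) + (-k *: (hval f0, Astar f0) + p));
  first exact: Tk.
move: fE; set af := a f; set bf := b f => fE.
rewrite /= {1}fE (congr1 (@hval _ _ _) fE) !hplusE Astar_gp Astar_gm.
apply: inner_ext => x; rewrite !innerE -/af.
by rewrite -/af in af0; rewrite /k -/af; field; rewrite af0 neq0Ci.
Qed.

(** * The system [Theta_10] *)

Lemma subr_fix (V : zmodType) (x y : V) : x - y = x -> y = 0.
Proof. by rewrite -[RHS]addr0 => /addrI/eqP; rewrite oppr_eq0 => /eqP. Qed.

Lemma bi_resolvent_eq (B : bop Adot) z u f :
  (forall d, B d = z *: embed Adot (hval d) -> d = 0) ->
  B f - z *: embed Adot (hval f) = u -> bi_resolvent B z u = f.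
Proof.
move=> Binj Bf; rewrite /bi_resolvent; case: xgetP => [h _ Bh|none]; last first.
  by case: (none f).
apply/eqP; rewrite -subr_eq0; apply/eqP/Binj;
  rewrite addrC -scaleN1r bop_linear.
apply: hminus_ext => x; have := congr1 (fun v : hminus Adot => v x) Bf.
rewrite -Bh !hminusE /= => Bx.
rewrite !innerE
  (_ : B h x = z * '[hval h, hval x] + (B f x - z * '[hval f, hval x])).
  by ring.
by rewrite Bx addrC subrK.
Qed.

(** Such a [d] has its image in [H], so it is an eigenvector of the quasi-kernel or zero, and a
    symmetric graph has no nonreal eigenvalue. *)
Lemma quasi_kernel_injective (B : bop Adot) z d :
  symmetric_graph (quasi_kernel B) -> complex.Im z != 0 ->
  B d = z *: embed Adot (hval d) -> d = 0.
Proof.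
move=> Bs z0 Bd; apply/val_inj/(symmetric_eigenvector Bs z0).
by exists d => //; apply: hminus_ext => x; rewrite Bd /= !innerE.
Qed.

Lemma conj_sqrt2 : (sqrtC 2 : C)^* = sqrtC 2.
Proof. by apply: geC0_conj; rewrite sqrtC_ge0 ler0n. Qed.

Lemma sqrt2M : sqrtC 2 * sqrtC 2 = 2 :> C.
Proof. by rewrite -expr2 sqrtCK. Qed.

Lemma sqrt2V : (sqrtC 2)^-1 * (sqrtC 2)^-1 = 2^-1 :> C.
Proof. by rewrite -invfM sqrt2M. Qed.

Lemma sqrt2_neq0 : sqrtC 2 != 0 :> C.
Proof. by rewrite sqrtC_eq0 pnatr_eq0. Qed.

Local Notation phi := (riesz_inv gp).
Local Notation psi := (riesz_inv gm).

Definition state10 : bop Adot := perturbation psi (phi - psi).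

Lemma state10E f h :
  state10 f h = '[Astar f, hval h] - 'i * b f * ((a h)^* - (b h)^*).
Proof.
by rewrite [state10 f]/(perturbation_fun _ _ _) /perturbation_fun !hminusE
  pairing_riesz.
Qed.

(** The boundary form trades [b f] for [a f]: passing to the adjoint replaces the functional [psi]
    by [phi] and keeps the direction [phi - psi]. *)
Lemma state10_adjE f h : (state10 h f)^* =
  '[Astar f, hval h] - 'i * a f * ((a h)^* - (b h)^*).
Proof.
rewrite state10E !rmorphB !rmorphM /= rmorphB /= !conjCK conjCi -inner_conj.
have := boundary_form f h => /eqP; rewrite subr_eq => /eqP ->; ring.
Qed.

Lemma state10_reE f h : bop_re state10 f h =
  '[Astar f, hval h] - 2^-1 * 'i * (a f + b f) * ((a h)^* - (b h)^*).
Proof. by rewrite bop_reE state10_adjE state10E; field. Qed.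

Lemma state10_imE f h : bop_im state10 f h =
  2^-1 * (a f - b f) * ((a h)^* - (b h)^*).
Proof. by rewrite bop_imE state10_adjE state10E; field; rewrite neq0Ci. Qed.

Definition main10_graph : set (H * H) :=
  [set p | exists2 f : hplus Adot, b f = 0 & p = (hval f, Astar f)].

Lemma main10_0 : main10_graph 0.
Proof.
exists (0 *: gp); first by rewrite inner_plusZ mul0r.
by rewrite AstarZ hvalZ !scale0r.
Qed.

Lemma main10_linear k p q :
  main10_graph p -> main10_graph q -> main10_graph (k *: p + q).
Proof.
move=> [f bf ->] [h bh ->]; exists (k *: f + h).
  by rewrite inner_plusD inner_plusZ bf bh mulr0 addr0.
by rewrite AstarD AstarZ.
Qed.

Lemma main10_functional x y z :
  main10_graph (x, y) -> main10_graph (x, z) -> y = z.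
Proof. by move=> [f _ [-> ->]] [h _ [/val_inj -> ->]]. Qed.

Definition main10 : operator H :=
  Operator main10_0 main10_linear main10_functional.

Lemma Adot_hplus x y : graph Adot (x, y) ->
  exists f : hplus Adot, [/\ (x, y) = (hval f, Astar f), a f = 0 & b f = 0].
Proof.
move=> xy; have [f [fx fy]] := Adot_lift xy; rewrite -fx -fy in xy *.
by exists f; rewrite Adot_gp// Adot_gm.
Qed.

Lemma main10_gp : main10_graph (hval gp, 'i *: hval gp).
Proof. by exists gp; rewrite ?inner_plus_gpm ?Astar_gp. Qed.

Lemma Adot_main10 : Adot `<=` main10.
Proof.
by move=> [x y] /Adot_hplus[f [-> _ bf]]; exists f.
Qed.

Lemma main10_adjoint : main10 `<=` adjoint Adot.
Proof. by move=> _ [f _ ->]; exact: AstarP. Qed.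

Lemma subset_adjoint (T : set (H * H)) :
  T `<=` adjoint Adot -> Adot `<=` adjoint T.
Proof.
by move=> TA p Ap q /TA/(_ p Ap) /(congr1 Num.conj); rewrite -!inner_conj.
Qed.

Lemma adjoint_subset (T : set (H * H)) :
  Adot `<=` T -> adjoint T `<=` adjoint Adot.
Proof. by move=> AT p Tp q /AT; exact: Tp. Qed.

(** Testing against [gp], which lies in the domain of [main10], leaves only the conjugate of [a f]
    in the boundary form. *)
Lemma adjoint_main10 f y : adjoint main10 (hval f, y) -> Astar f = y /\ a f = 0.
Proof.
move=> Tf; have fy := AstarE (adjoint_subset Adot_main10 Tf); split=> //.
have := boundary_form gp f; rewrite fy Astar_gp (Tf _ main10_gp) /= subrr.
rewrite inner_plus_gpp inner_plus_gpm mul1r mul0r subr0 => /esym/eqP.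
by rewrite mulf_eq0 (negPf (neq0Ci _)) conjC_eq0 => /eqP.
Qed.

Lemma main10_dissipative : dissipative main10.
Proof.
move=> _ [f bf ->] /=; rewrite -ler0c Im_Astar bf normr0 expr0n subr0.
by rewrite mulr_ge0 ?exprn_ge0// invr_ge0 ler0n.
Qed.

Lemma main10_not_symmetric : ~ symmetric_graph main10.
Proof.
move=> /symmetric_Im/(_ main10_gp) /= Im0; have := Im_Astar gp.
rewrite Astar_gp Im0 inner_plus_gpp inner_plus_gpm normr1 normr0 expr1n expr0n
  subr0 mulr1.
by move=> /esym/eqP; rewrite invr_eq0 pnatr_eq0.
Qed.

Lemma main10_extension : quasi_self_adjoint_extension Adot main10.
Proof.
by split; [exact: main10_not_symmetric|exact: Adot_main10|exact:
  main10_adjoint].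
Qed.

Lemma main10_regular : resolvent_set main10 (- 'i).
Proof.
apply: (@dissipative_resolvent main10 gp).
- exact: main10_dissipative.
- exact: Adot_main10.
- by rewrite Astar_gp; exact: main10_gp.
- by rewrite inner_plus_gpp oner_neq0.
Qed.

(** * The extension [A] as quasi-kernel of the real part *)

Variable A : operator H.
Hypothesis A_extends : Adot `<=` A.
Hypothesis A_self_adjoint : self_adjoint A.
Hypothesis A_dom : dom A (hval gp - hval gm).

(** Symmetry tested against [gp - gm] forces [a + b = 0] on the domain of [A]. Conversely, two
    vectors with [a + b = 0] have zero boundary form, so such an [f] lies in the domain of the
    adjoint of [A], which is [A]. *)
Lemma A_graphE f : graph A (hval f, Astar f) <-> a f + b f = 0.
Proof.
have A_adj : A `<=` adjoint Adot.
  by rewrite -A_self_adjoint; exact: adjoint_subset.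
have A_sym : symmetric_graph A by rewrite /symmetric_graph A_self_adjoint.
have A_gpm : graph A (hval (gp - gm), Astar (gp - gm)).
  by have [y Ay] := A_dom; rewrite (AstarE (f := gp - gm) (A_adj _ Ay)).
have A0 h : graph A (hval h, Astar h) -> a h + b h = 0.
  move=> Ah; have := boundary_form h (gp - gm);
    rewrite (A_sym _ A_gpm _ Ah) subrr.
  rewrite !inner_plusB inner_plus_gpp inner_plus_gpm inner_plus_gmp
    inner_plus_gmm.
  rewrite subr0 sub0r rmorphN /= conjC1 mulr1 mulrN1 opprK => /esym/eqP.
  by rewrite mulf_eq0 (negPf (neq0Ci _)) => /eqP.
split=> [|af0]; first exact: A0.
rewrite -A_self_adjoint => -[x y] Axy /=.
have [h [hx hy]] := Astar_lift (A_adj _ Axy); rewrite -hx -hy in Axy *.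
apply/eqP; rewrite -subr_eq0 boundary_form.
have -> : b h = - a h by apply/eqP; rewrite -addr_eq0 addrC A0.
have -> : b f = - a f by apply/eqP; rewrite -addr_eq0 addrC af0.
by rewrite rmorphN /= mulrNN subrr mulr0.
Qed.

Lemma quasi_kernel10 : quasi_kernel (bop_re state10) = A.
Proof.
have A_adj : A `<=` adjoint Adot.
  by rewrite -A_self_adjoint; exact: adjoint_subset.
apply/seteqP; split=> -[x y].
  move=> [f /= <- Bf].
  (* Testing against the domain of [Adot] removes the singular term and gives [y = S f]; testing
     against [gp] afterwards isolates [a f + b f]. *)
  have fy : Astar f = y.
    apply: AstarE => -[_ _] /Adot_hplus[h [[-> ->] ah bh]] /=.
    have := congr1 (fun v : hminus Adot => v h) Bf.
    rewrite state10_reE ah bh subrr mulr0 subr0 embedE => fh.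
    rewrite inner_conj [RHS]inner_conj -fh; congr (_^*).
    have := boundary_form f h; rewrite ah bh rmorph0 !mulr0 subrr mulr0 => /eqP.
    by rewrite subr_eq0 => /eqP ->.
  rewrite -fy; apply/A_graphE.
  have := congr1 (fun v : hminus Adot => v gp) Bf.
  rewrite state10_reE embedE fy inner_plus_gpp inner_plus_gpm rmorph1 rmorph0
    subr0 mulr1.
  move=> /subr_fix/eqP; rewrite !mulf_eq0 invr_eq0 pnatr_eq0.
  by rewrite (negPf (neq0Ci _)) => /eqP.
move=> Axy; have [f [fx fy]] := Astar_lift (A_adj _ Axy);
  rewrite -fx -fy in Axy *.
exists f => //; apply: hminus_ext => h; rewrite state10_reE embedE.
by move/A_graphE : Axy => ->; rewrite mulr0 mul0r subr0.
Qed.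

Lemma bop_re_adj (B : bop Adot) : bop_adj (bop_re B) = bop_re B.
Proof.
apply/val_inj/funext => f; apply: hminus_ext => h.
rewrite bop_adjE !bop_reE rmorphM rmorphD /= conjCK fmorphV rmorph_nat.
by rewrite addrC.
Qed.

Lemma state10_star : star_extension main10 state10.
Proof.
split; split.
- move=> f y [h bh [/val_inj -> ->]]; apply: hminus_ext => x.
  by rewrite state10E bh mulr0 mul0r subr0.
- exact: Adot_main10.
- move=> f y /adjoint_main10[<- af]; apply: hminus_ext => x.
  by rewrite bop_adjE state10_adjE af mulr0 mul0r subr0.
- exact/subset_adjoint/main10_adjoint.
- split; last exact: bop_re_adj.
  move=> f y /Adot_hplus[h [[/val_inj -> ->] ah bh]]; apply: hminus_ext => x.
  by rewrite state10_reE ah bh addr0 mulr0 mul0r subr0.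
- by rewrite quasi_kernel10.
Qed.

Definition channel10 : {linear C^o -> hminus Adot} :=
  scale_channel ((sqrtC 2)^-1 *: (phi - psi)).

Lemma channel10E c f : channel10 c f = c * ((sqrtC 2)^-1 * ((a f)^* - (b f)^*)).
Proof. by rewrite -!riesz_inv_conj. Qed.

Lemma channel10_adjE f : channel_adj channel10 f = (sqrtC 2)^-1 * (a f - b f).
Proof.
rewrite /channel_adj /pairing channel10E mul1r rmorphM fmorphV /= conj_sqrt2.
by rewrite rmorphB /= !conjCK.
Qed.

Lemma state10_im f : bop_im state10 f = channel10 (channel_adj channel10 f).
Proof.
apply: hminus_ext => h; rewrite channel10E channel10_adjE state10_imE.
by rewrite -sqrt2V; ring.
Qed.

Definition Theta10 : l_system Adot := @LSystem _ _ _ main10 state10 channel10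
  indices main10_extension main10_dissipative (ex_intro _ _ main10_regular)
  state10_star state10_im.

Lemma transfer10 : transfer Theta10 (- 'i) = 0.
Proof.
rewrite /transfer /=.
rewrite (@bi_resolvent_eq _ _ _ (('i / sqrtC 2) *: gm)).
- rewrite channel10_adjE !inner_plusZ inner_plus_gmp inner_plus_gmm mulr0 mulr1
  sub0r.
  apply: (eq_mod_i (k := 1)); have := sqrt2M; have := sqrt2_neq0.
  by move: (sqrtC 2) => s s0 s2; rewrite -[in LHS]s2; field.
(* Injectivity: testing against the domain of [Adot] puts [d] in [Ker (S + i)], so [d] is a multiple
   of [gm]; testing against [gp] then gives [b d = 0]. *)
- move=> d Bd.
  have dm : adjoint Adot (hval d, - 'i *: hval d).
    move=> [_ _] /Adot_hplus[h [[-> ->] ah bh]] /=.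
    have := congr1 (fun v : hminus Adot => v h) Bd.
    rewrite state10E ah bh subrr mulr0 subr0 hminusZE embedE => dh.
    have := boundary_form d h;
      rewrite ah bh rmorph0 !mulr0 subrr mulr0 dh => /eqP.
    rewrite subr_eq0 => /eqP dh'; rewrite inner_conj -dh' rmorphM /= innerZr.
    by rewrite -inner_conj.
  have [c dc] := gm_span dm.
  have {}dc : d = c *: gm by apply: val_inj.
  have := congr1 (fun v : hminus Adot => v gp) Bd.
  rewrite state10E hminusZE embedE (AstarE dm) innerZl inner_plus_gpp
    inner_plus_gpm.
  rewrite rmorph1 rmorph0 subr0 mulr1 => /subr_fix/eqP.
  rewrite mulf_eq0 (negPf (neq0Ci _)) dc inner_plusZ inner_plus_gmm mulr1 =>
    /eqP ->.
  by rewrite scale0r.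
- apply: hminus_ext => x;
  rewrite channel10E hminusBE hminusZE embedE state10E AstarZ hvalZ Astar_gm.
  rewrite !inner_plusZ inner_plus_gmm !innerE.
  apply: (eq_mod_i (k := - (sqrtC 2)^-1 * ((a x)^* - (b x)^*))).
  by field; rewrite sqrt2_neq0.
Qed.

Lemma c_entropy10 : c_entropy Theta10 = +oo%E.
Proof. by rewrite /c_entropy transfer10 eqxx. Qed.

(** The von Neumann parameter is [0], and on the unit vector [sqrtC 2 *: gp] the operator acts as
    multiplication by ['i]. *)
Lemma dissipation_gp (T : set (H * H)) :
  T (sqrtC 2 *: hval gp, sqrtC 2 *: Astar gp) ->
  dissipation_coefficient T (sqrtC 2 *: hval gp) (sqrtC 2 *: hval gm) 1.
Proof.
move=> Tgp; exists 0, (sqrtC 2 *: Astar gp); rewrite scale0r subr0; split=> //.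
  by rewrite lexx ltr01.
rewrite !innerE conj_sqrt2 Astar_gp innerZl inner_gpp.
by rewrite mulrA sqrt2M (_ : 2 * ('i / 2) = 'i) ?Im_i//; field.
Qed.

(** * The impedance function of [Theta10] *)

Variable g : H.
Hypothesis g_def : deficiency_space Adot 'i g.
Hypothesis g_norm : `|g| = 1.

Let gg : '[g, g] = 1. Proof. by rewrite -sqr_normE g_norm expr1n. Qed.

Lemma A_functional x y z : graph A (x, y) -> graph A (x, z) -> y = z.
Proof. exact: graph_functional. Qed.

(** The Weyl-Titchmarsh function for a unit vector [g], written through the resolvent so that
    differentiability and conjugation symmetry can be read off. *)
Definition impedance10 (z : C) : C :=
  z + (z * z + 1) * '[resolvent A z g, g].

Lemma impedance10E z : complex.Im z != 0 ->
  impedance10 z = weyl_titchmarsh A g z.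
Proof.
by move=> z0; rewrite (weyl_titchmarshE A_self_adjoint _ A_functional)// gg
  mulr1.
Qed.

Lemma impedance10_derivable z : complex.Im z != 0 ->
  derivable (impedance10 : C^o -> C^o) z 1.
Proof.
move=> z0; apply: (@derivableD _ C^o C^o); first exact: derivable_id.
apply: (@derivableM _ C^o); last exact: resolvent_derivable.
apply: (@derivableD _ C^o C^o); last exact: derivable_cst.
by apply: (@derivableM _ C^o); exact: derivable_id.
Qed.

Lemma impedance10_conj z : complex.Im z != 0 ->
  impedance10 z^* = (impedance10 z)^*.
Proof.
move=> z0; rewrite /impedance10 rmorphD rmorphM /= rmorphD /= rmorphM rmorph1
  /=.
rewrite (resolvent_adjoint A_self_adjoint (z := z^*)) ?Im_conj ?oppr_eq0//.
by rewrite conjCK -inner_conj.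
Qed.

Lemma impedance10_bi_resolvent z : complex.Im z != 0 ->
  impedance10 z =
    channel_adj channel10 (bi_resolvent (bop_re state10) z (channel10 1)).
Proof.
move=> z0; have [u gu] := gp_span g_def.
(* The vector [g] has norm one, while [gp] has squared norm one half in [H]. *)
have uu : u * u^* = 2.
  have := gg; rewrite gu !innerE inner_gpp => uu2.
  by rewrite -[LHS](@divfK _ 2) ?pnatr_eq0// -(mulrA u) uu2 mul1r.
have u0 : u != 0 by apply: contra_eq_neq uu => ->;
  rewrite mul0r eq_sym pnatr_eq0.
have gpg x : '[x, hval gp] = u * 2^-1 * '[x, g].
  rewrite gu innerZr; apply: (@mulfI _ 2); rewrite ?pnatr_eq0//.
  by rewrite -{1}uu; field.
have Ar := resolventP A_self_adjoint g z0; set r := resolvent A z g in Ar *.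
have [h [hr hA]] : exists h : hplus Adot, hval h = r /\ Astar h = g + z *: r.
  by apply: Astar_lift; apply: (adjoint_subset A_extends);
    rewrite A_self_adjoint.
have hab : b h = - a h.
  apply/eqP; rewrite -addr_eq0 addrC; apply/eqP/A_graphE.
  by rewrite hr hA.
have ha : a h = u * 2^-1 * ('[r, g] - 'i * (1 + z * '[r, g])).
  rewrite (inner_plus_deficiency _ Astar_gp) hr hA gpg !innerE gg conjCi.
  by rewrite mulNr.
pose f : hplus Adot := u *: gp + (z - 'i) *: h.
have Af : Astar f = z *: hval f.
  rewrite /f !hplusE Astar_gp hr hA gu; apply: inner_ext => x.
  by rewrite !innerE; ring.
have fa : a f = u + (z - 'i) * a h.
  by rewrite inner_plusD !inner_plusZ inner_plus_gpp mulr1.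
have fb : b f = - ((z - 'i) * a h).
  by rewrite inner_plusD !inner_plusZ inner_plus_gpm mulr0 add0r hab mulrN.
have s0 := sqrt2_neq0.
(* Since [a f + b f = u], the real part minus [z] sends [f] to [- (i / 2) u (phi - psi)]; the scalar
   turns this into [channel10 1]. *)
rewrite (@bi_resolvent_eq _ _ _ ((sqrtC 2 * 'i / u) *: f)).
- rewrite channel10_adjE !inner_plusZ fa fb ha /impedance10 -/r.
  move: (sqrtC 2) s0 => s s0.
  set t := '[r, g].
  apply/esym/(eq_mod_i (k := 'i + 'i * z * t - t - z - z * z * t)).
  by field; rewrite u0 s0.
- move=> d; apply: (quasi_kernel_injective _ z0).
  by rewrite quasi_kernel10 /symmetric_graph A_self_adjoint.
- apply: hminus_ext => x.
  rewrite channel10E hminusBE hminusZE embedE state10_reE AstarZ hvalZ Af.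
  rewrite !inner_plusZ fa fb !innerE mul1r.
  set t := (_ - _^*).
  have -> : (sqrtC 2)^-1 = 2^-1 * sqrtC 2 :> C by rewrite -sqrt2V mulfVK.
  apply: (eq_mod_i (k := - (2^-1 * sqrtC 2 * t))).
  by field.
Qed.

Lemma impedance_Theta10 : impedance Theta10 impedance10.
Proof.
split=> [z z0|z z0 _|z z0].
- exact: impedance10_derivable.
- exact: impedance10_bi_resolvent.
- exact: impedance10_conj.
Qed.

Lemma Theta10_represents_weyl_titchmarsh : exists Theta : l_system Adot,
     [/\ forall f, state_operator Theta f =
           embed Adot (Astar f) - ('i * pairing f psi) *: (phi - psi),
         forall c : R[i], channel Theta c =
           c *: ((sqrtC 2)^-1 *: (phi - psi)),
         exists2 V, impedance Theta V &
           forall z : R[i], 0 < complex.Im z -> V z = weyl_titchmarsh A g z,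
         c_entropy Theta = +oo%E &
         dissipation_coefficient (main_operator Theta)
           (sqrtC 2 *: hval gp) (sqrtC 2 *: hval gm) 1].
Proof.
exists Theta10; split=> //.
- exists impedance10; first exact: impedance_Theta10.
  by move=> z z0; rewrite impedance10E// gt_eqF.
- exact: c_entropy10.
- apply: dissipation_gp; exists (sqrtC 2 *: gp); last by rewrite AstarZ.
  by rewrite inner_plusZ inner_plus_gpm mulr0.
Qed.

(** * Systems whose impedance function is [M] *)

Lemma bop0 (B : bop Adot) : B 0 = 0.
Proof.
by have := bop_linear B (-1) 0 0; rewrite scaleN1r addNr scaleN1r addNr.
Qed.

Lemma bopZ (B : bop Adot) k f : B (k *: f) = k *: B f.
Proof. by rewrite -[k *: f]addr0 bop_linear bop0 addr0. Qed.

Lemma bopB (B : bop Adot) f h : B (f - h) = B f - B h.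
Proof. by rewrite addrC -scaleN1r bop_linear scaleN1r addrC. Qed.

Lemma bop_eigenE (B : bop Adot) z f u h :
  B f - z *: embed Adot (hval f) = u -> B f h - z * '[hval f, hval h] = u h.
Proof. by move=> <-. Qed.

Lemma bop_linearE (B : bop Adot) k f h x :
  B (k *: f + h) x = k * B f x + B h x.
Proof. by rewrite bop_linear. Qed.

Lemma pairingZ c f (u : hminus Adot) : pairing (c *: f) u = c * pairing f u.
Proof.
rewrite /pairing -[c *: f]addr0 hminus_antilinear.
have -> : u 0 = 0.
  have := hminus_antilinear u (-1) 0 0.
  by rewrite scaleN1r addNr rmorphN /= conjC1 mulN1r addNr.
by rewrite addr0 rmorphM /= conjCK.
Qed.

(** With [pairing f chi = - 'i] the rank-one term equals [- chi] and cancels the right-hand side of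
    the equation for [B]. *)
Lemma bop_adj_eigen (SA B : bop Adot) (chi : hminus Adot) f :
  (forall f h, (SA h f)^* = B f h - 'i * pairing f chi * chi h) ->
  B f - - 'i *: embed Adot (hval f) = chi -> pairing f chi = - 'i ->
  forall h, (SA h f)^* = - 'i * '[hval f, hval h].
Proof.
move=> SAE Bf kf h; rewrite SAE kf; have := bop_eigenE h Bf.
move: (chi h) (B f h) => x y <-.
by apply: (eq_mod_i (k := y + 'i * '[hval f, hval h])); ring.
Qed.

(** On [f] the rank-one term equals [chi], so [SA + i] sends [f] to [2 chi] and the solution is
    [f / 2]. Its pairing with [chi] is [- i / 2]. *)
Lemma bi_resolvent_eq0 (SA B : bop Adot) (chi : hminus Adot) f :
  (forall f h, SA f h = B f h + 'i * pairing f chi * chi h) ->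
  (forall d, B d = - 'i *: embed Adot (hval d) -> d = 0) ->
  B f - - 'i *: embed Adot (hval f) = chi -> pairing f chi = - 'i ->
  1 - 2 * 'i * pairing (bi_resolvent SA (- 'i) chi) chi = 0.
Proof.
move=> SAE Binj Bf kf.
have Bfh h : B f h = chi h - 'i * '[hval f, hval h].
  have := bop_eigenE h Bf.
  by move: (chi h) (B f h) => x y <-; ring.
rewrite (@bi_resolvent_eq _ _ _ (2^-1 *: f)).
- by rewrite pairingZ kf; apply: (eq_mod_i (k := 1)); field.
(* Injectivity: [B + i] kills [d + i k f], so [d = - i k f]; pairing with [chi] gives [k = - k]. *)
- move=> d Ad; set k := pairing d chi.
  have Bd h : B d h = - 'i * '[hval d, hval h] - 'i * k * chi h.
    have := congr1 (fun v : hminus Adot => v h) Ad.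
    by rewrite SAE hminusZE embedE => /(canRL (addrK _)).
  have dE : d + 'i * k *: f = 0.
    apply: (Binj); rewrite addrC; apply: hminus_ext => h.
    rewrite bop_linearE Bd Bfh hminusZE embedE hvalD hvalZ innerDl innerZl.
    by move: (chi h) => x; ring.
  have dk : d = (- ('i * k)) *: f.
    by apply/eqP; rewrite scaleNr -addr_eq0 dE.
  have k0 : k = 0.
    have : k = - ('i * k) * - 'i by rewrite {1}/k dk pairingZ kf.
    rewrite mulrNN mulrAC ii mulN1r => /eqP.
    by rewrite -subr_eq0 opprK -mulr2n mulrn_eq0 => /eqP.
  by rewrite dk k0 mulr0 oppr0 scale0r.
- apply: hminus_ext => h; rewrite hminusBE hminusZE embedE SAE pairingZ kf.
  rewrite bopZ hminusZE Bfh hvalZ innerZl; move: (chi h) => x.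
  by apply: (eq_mod_i (k := - 2^-1 * x)); field.
Qed.

Lemma state_reimE (B : bop Adot) f h :
  B f h = bop_re B f h + 'i * bop_im B f h.
Proof. by rewrite bop_reE bop_imE; field; rewrite neq0Ci. Qed.

Lemma state_adj_reimE (B : bop Adot) f h :
  (B h f)^* = bop_re B f h - 'i * bop_im B f h.
Proof. by rewrite bop_reE bop_imE; field; rewrite neq0Ci. Qed.

Lemma channelE (K : {linear C^o -> hminus Adot}) c : K c = c *: K 1.
Proof. by rewrite -linearZ; congr (K _); rewrite [RHS]mulr1. Qed.

(** If [a] vanished on the domain of [T], dissipativity would force [b] to vanish too, and [T] would
    be contained in the symmetric [Adot]. *)
Lemma dissipative_extension_coeff (T : set (H * H)) :
  quasi_self_adjoint_extension Adot T -> dissipative T ->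
  exists f : hplus Adot, T (hval f, Astar f) /\ a f != 0.
Proof.
move=> [Tns AT TA] Td; apply: contra_notP Tns => none.
have T0 : T `<=` Adot.
  move=> [x y] Txy; have [f [fx fy]] := Astar_lift (TA _ Txy).
  rewrite -fx -fy in Txy *.
  have af : a f = 0.
    by apply: contra_notP none => /eqP af; exists f.
  apply: Adot_of_coeff => //; have := Td _ Txy.
  rewrite /= -ler0c Im_Astar af normr0 expr0n sub0r mulrN oppr_ge0.
  rewrite pmulr_rle0 ?invr_gt0 ?ltr0n// => bf; apply/eqP.
  by rewrite -normr_eq0 -sqrf_eq0 eq_le bf exprn_ge0.
by move=> p Tp q Tq; exact: (sym_symmetric (T0 _ Tp) (T0 _ Tq)).
Qed.

Section System.
Variable Theta : l_system Adot.
Local Notation T := (main_operator Theta).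
Local Notation SA := (state_operator Theta).
Local Notation K := (channel Theta).
Local Notation B := (bop_re SA).
Local Notation Q := (quasi_kernel B).

Lemma quasi_kernel_self_adjoint : self_adjoint Q.
Proof. by have [_ _ []] := l_system_star Theta. Qed.

Lemma Adot_quasi_kernel : Adot `<=` Q.
Proof.
have [_ _ [[Bext _] _]] := l_system_star Theta.
by move=> [x y] Axy; have [f [fx fy]] := Adot_lift Axy; exists f => //;
  apply: Bext; rewrite fx.
Qed.

Lemma quasi_kernel_adjoint : Q `<=` adjoint Adot.
Proof.
by rewrite -quasi_kernel_self_adjoint; exact/adjoint_subset/Adot_quasi_kernel.
Qed.

Lemma quasi_kernel_functional x y z : Q (x, y) -> Q (x, z) -> y = z.
Proof.
move=> /quasi_kernel_adjoint xy /quasi_kernel_adjoint.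
exact: adjoint_functional (sym_dense Adot) xy.
Qed.

Lemma stateE f h : SA f h = B f h + 'i * channel_adj K f * K 1 h.
Proof. by rewrite state_reimE l_system_im channelE hminusZE mulrA. Qed.

Lemma state_adjE f h : (SA h f)^* = B f h - 'i * channel_adj K f * K 1 h.
Proof. by rewrite state_adj_reimE l_system_im channelE hminusZE mulrA. Qed.

(** The vector [K 1] need not lie in [H], so the resolvent of the quasi-kernel cannot be applied to
    it. Instead, a [q] in the domain of [T] produces a multiple of [K 1] plus a vector of [H], and
    the quasi-kernel removes the latter. *)
Lemma re_resolvent_exists : exists f,
  B f + 'i *: embed Adot (hval f) = K 1 /\
  adjoint Adot (hval f, - 'i *: hval f).
Proof.
have [Tns AT TA] := l_system_quasi_self_adjoint Theta.
have [[SAT _] _ _] := l_system_star Theta.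
(* Were [K^*] zero on the domain of [T], then [T] would be contained in the self-adjoint
   quasi-kernel and be symmetric. *)
have [q [Tq Kq]] : exists q : hplus Adot,
    graph T (hval q, Astar q) /\ channel_adj K q != 0.
  apply: contra_notP Tns => none.
  have TQ : T `<=` Q.
    move=> [x y] Txy; have [f [fx fy]] := Astar_lift (TA _ Txy).
    rewrite -fx -fy in Txy *; exists f => //; apply: hminus_ext => h.
    have Kf : channel_adj K f = 0.
      by apply: contra_notP none => /eqP Kf; exists f.
    by rewrite -(SAT _ _ Txy) stateE Kf mulr0 mul0r addr0.
  move=> p /TQ; rewrite -quasi_kernel_self_adjoint => Qp r /TQ Qr.
  exact: Qp.
have iN0 : complex.Im (- 'i : C) != 0.
  by rewrite -conjCi Im_conj Im_i oppr_eq0 oner_neq0.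
have [x Qx] := self_adjoint_onto (Astar q + 'i *: hval q)
  quasi_kernel_self_adjoint iN0.
have [f [fx fA]] := Astar_lift (quasi_kernel_adjoint Qx).
rewrite -fx in Qx fA.
have Bf : B f = embed Adot (Astar f).
  by have [f' /val_inj -> ->] := Qx; rewrite fA.
pose y := q - f.
have yA : Astar y = - 'i *: hval y.
  by rewrite !hplusE fA; apply: inner_ext => v; rewrite !innerE; ring.
(* [B + i] sends both [q] and [f] to [(S + i) q], up to the term [- i (K^* q) K 1] for [q]; hence it
   sends [y = q - f] to that term, and [k] normalizes it. *)
pose k := - ('i * channel_adj K q)^-1.
have ik : 'i * channel_adj K q != 0 by rewrite mulf_neq0 ?neq0Ci.
exists (k *: y); split; last first.
  by have := AstarP (k *: y); rewrite AstarZ yA !scalerA (mulrC k).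
apply: hminus_ext => h.
have Byh : B y h = B q h - B f h by rewrite bopB.
suff : k * B y h + 'i * (k * '[hval y, hval h]) = K 1 h.
  by rewrite bopZ -innerZl; exact.
rewrite Byh Bf embedE.
have := stateE q h; rewrite (SAT _ _ Tq) embedE => /esym/(canRL (addrK _)) ->.
have /esym := congr1 (fun v => '[v, hval h]) yA.
rewrite AstarB hvalB innerZl !innerBl => yh.
rewrite mulrCA -mulrDr.
have -> : '[Astar q, hval h] - 'i * channel_adj K q * K 1 h -
    '[Astar f, hval h] + 'i * ('[hval q, hval h] - '[hval f, hval h]) =
    - ('i * channel_adj K q * K 1 h).
  by rewrite [X in X + _]addrAC -yh; ring.
by rewrite /k mulrNN mulKf.
Qed.

(** At ['i] the resolvent term of the Weyl-Titchmarsh function is multiplied by zero; conjugation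
    symmetry moves the value to [- 'i]. *)
Lemma impedance_at_i V :
  impedance Theta V ->
  (forall z : C, 0 < complex.Im z -> V z = weyl_titchmarsh Q g z) ->
  V (- 'i) = - 'i.
Proof.
move=> [_ _ Vconj] VM; have i0 : 0 < complex.Im ('i : C) by rewrite Im_i ltr01.
rewrite -conjCi Vconj ?gt_eqF// VM// weyl_titchmarshE ?gt_eqF//.
- by rewrite gg mulr1 sqrCi addNr mul0r addr0.
- exact: quasi_kernel_self_adjoint.
- exact: quasi_kernel_functional.
Qed.

Variable V : C -> C.
Hypothesis Vimp : impedance Theta V.
Hypothesis Vi : V (- 'i) = - 'i.

Let iN0 : complex.Im (- 'i : C) != 0.
Proof. by rewrite -conjCi Im_conj Im_i oppr_eq0 oner_neq0. Qed.

Lemma re_injective d : B d = - 'i *: embed Adot (hval d) -> d = 0.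
Proof.
apply: quasi_kernel_injective => //.
by rewrite /symmetric_graph quasi_kernel_self_adjoint.
Qed.

Lemma re_resolvent : exists f, [/\ B f - - 'i *: embed Adot (hval f) = K 1,
  adjoint Adot (hval f, - 'i *: hval f) & channel_adj K f = - 'i].
Proof.
have [f [Bf fA]] := re_resolvent_exists; exists f.
have Bf' : B f - - 'i *: embed Adot (hval f) = K 1 by rewrite scaleNr opprK.
split=> //; have [_ Vform _] := Vimp; rewrite -Vi Vform//.
  by rewrite (bi_resolvent_eq re_injective Bf').
(* The resolvent formula for [V] may be used at [- 'i] once this point is known to be regular for
   [T]. *)
have [q [Tq aq]] := dissipative_extension_coeff
  (l_system_quasi_self_adjoint Theta) (@l_system_dissipative _ _ _ Theta).
apply: (dissipative_resolvent _ _ Tq) => //; first exact: l_system_dissipative.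
by have [_ AT _] := l_system_quasi_self_adjoint Theta.
Qed.

Lemma transfer_eq0 : transfer Theta (- 'i) = 0.
Proof.
have [f [Bf _ Kf]] := re_resolvent.
exact: (bi_resolvent_eq0 stateE re_injective Bf Kf).
Qed.

Lemma gp_main_operator : graph T (hval gp, Astar gp).
Proof.
have [Tns AT TA] := l_system_quasi_self_adjoint Theta.
have [[SAT _] _ _] := l_system_star Theta.
have [f [Bf fA Kf]] := re_resolvent.
have [c fc] := gm_span fA.
have c0 : c != 0.
  apply/eqP => c0; have f0 : f = 0 by apply: val_inj; rewrite /= fc c0 scale0r.
  move: Kf; rewrite f0 -(scale0r f) [LHS]pairingZ mul0r => /eqP.
  by rewrite eq_sym oppr_eq0 (negPf (neq0Ci _)).
have adjf h : (SA h f)^* = - 'i * '[hval f, hval h].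
  exact: (bop_adj_eigen state_adjE Bf Kf).
have [q [Tq aq]] := dissipative_extension_coeff
  (l_system_quasi_self_adjoint Theta) (@l_system_dissipative _ _ _ Theta).
(* The adjoint of the state operator sends [f] to [- i f], which is also [S f]. The boundary form of
   [q] and [f = c gm] therefore vanishes, and it is a nonzero multiple of [b q]. *)
have bq : b q = 0.
  have := boundary_form q f; rewrite (AstarE fA).
  have -> : '[Astar q, hval f] = '[hval q, - 'i *: hval f].
    rewrite -embedE -(SAT _ _ Tq) -[LHS]conjCK adjf.
    by rewrite innerZr rmorphM /= -inner_conj.
  have fg : f = c *: gm by apply: val_inj.
  rewrite subrr fg !inner_plusZ inner_plus_gmp inner_plus_gmm mulr0 mulr1
    rmorph0 mulr0.
  rewrite sub0r => /esym/eqP;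
    rewrite mulf_eq0 (negPf (neq0Ci _)) oppr_eq0 mulf_eq0.
  by rewrite conjC_eq0 (negPf c0) orbF => /eqP.
have [q0 [Aq0 qE]] := von_Neumann_decomposition q.
move: qE; rewrite bq scale0r addr0 => qE.
(* With [b q = 0], von Neumann's decomposition expresses [gp] through [q] and [q0], both in the
   domain of [T]. *)
have gq : gp = (a q)^-1 *: (-1 *: q0 + q).
  by rewrite {2}qE scaleN1r addKr scalerA mulVf// scale1r.
rewrite gq AstarZ hvalZ AstarD AstarZ hvalD hvalZ.
have := graph_linear (o := T) ((a q)^-1) (graph_linear (-1) (AT _ Aq0) Tq)
  (graph0 T).
by rewrite addr0.
Qed.

End System.

Lemma weyl_titchmarsh_impedance_entropy (Theta : l_system Adot) (V : C -> C) :
  impedance Theta V ->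
  (forall z : C, 0 < complex.Im z ->
     V z =
     weyl_titchmarsh (quasi_kernel (bop_re (state_operator Theta))) g z) ->
  c_entropy Theta = +oo%E /\
  dissipation_coefficient (main_operator Theta)
    (sqrtC 2 *: hval gp) (sqrtC 2 *: hval gm) 1.
Proof.
move=> Vimp VM; have Vi := impedance_at_i Vimp VM.
split; first by rewrite /c_entropy (transfer_eq0 Vimp Vi) eqxx.
apply: dissipation_gp.
have := graph_linear (sqrtC 2) (gp_main_operator Vimp Vi) (graph0
  (main_operator Theta)).
by rewrite addr0.
Qed.

End Boundary.

Theorem theorem13 (R : realType) (H : hilbertType R)
  (Adot : symmetric_operator H) (gp gm : hplus Adot) (A : operator H) (g : H)
  (Adot_indices : deficiency_indices_1_1 Adot)
  (gp_def : deficiency_space Adot 'i (hval gp))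
  (gm_def : deficiency_space Adot (- 'i) (hval gm))
  (gp_norm : norm_plus gp = 1)
  (gm_norm : norm_plus gm = 1)
  (A_extends : Adot `<=` A)
  (A_self_adjoint : self_adjoint A)
  (A_dom : dom A (hval gp - hval gm))
  (g_def : deficiency_space Adot 'i g)
  (g_norm : `|g| = 1) :
  let phi := riesz_inv gp in
  let psi := riesz_inv gm in
  let gp' := sqrtC 2 *: hval gp in
  let gm' := sqrtC 2 *: hval gm in
  (exists Theta : l_system Adot,
     [/\ forall f, state_operator Theta f =
           embed Adot (Astar f) - ('i * pairing f psi) *: (phi - psi),
         forall c : R[i], channel Theta c =
           c *: ((sqrtC 2)^-1 *: (phi - psi)),
         exists2 V, impedance Theta V &
           forall z : R[i], 0 < complex.Im z -> V z = weyl_titchmarsh A g z,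
         c_entropy Theta = +oo%E &
         dissipation_coefficient (main_operator Theta) gp' gm' 1]) /\
  (forall (Theta : l_system Adot) (V : R[i] -> R[i]),
     impedance Theta V ->
     (forall z : R[i], 0 < complex.Im z ->
        V z = weyl_titchmarsh (quasi_kernel (bop_re (state_operator Theta))) g z) ->
     c_entropy Theta = +oo%E /\
     dissipation_coefficient (main_operator Theta) gp' gm' 1).
Proof.
move=> phi psi gp' gm'; split; first exact: Theta10_represents_weyl_titchmarsh.
by move=> Theta V; exact: weyl_titchmarsh_impedance_entropy.
Qed.
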